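(* Let $n=m2^a$, where $m$ is an odd positive integer and $a\geq1$. The number of Euclidean self-dual cyclic codes of length $n=m2^a$ over $\mathbb{Z}_4$ is \[ N_{\rm E}(\mathbb{Z}_4,2^a ) \times \prod_{h\in J_1} N_{\rm H}( {\rm GR}(4, m_h),2^a ) \times \prod_{k\in J_2'} N({\rm GR}(4, m_k),2^a ),\] where the empty product is regarded as $1$.
   Context: ${\rm GR}(4,r)$ is the Galois extension of $\mathbb{Z}_4$ of degree $r$ (so ${\rm GR}(4,1)=\mathbb{Z}_4$), with Teichmüller set $\mathcal{T}_r=\{0,1,\xi,\dots,\xi^{2^r-2}\}$ ($\xi$ of multiplicative order $2^r-1$); every element is uniquely $a_0+2b_0$ with $a_0,b_0\in\mathcal{T}_r$. For $r$ even, $\overline{a_0+2b_0}=a_0^{2^{r/2}}+2b_0^{2^{r/2}}$ is a ring automorphism. A cyclic code of length $n$ over ${\rm GR}(4,r)$ is a submodule of ${\rm GR}(4,r)^n$ invariant under the cyclic shift (equivalently, an ideal of ${\rm GR}(4,r)[X]/\langle X^n-1\rangle$). It is Euclidean self-dual if it equals its dual with respect to $\sum_i u_iv_i$ and, for $r$ even, Hermitian self-dual if it equals its dual with respect to $\sum_i u_i\overline{v_i}$. $N({\rm GR}(4,r),n)$, $N_{\rm E}({\rm GR}(4,r),n)$, $N_{\rm H}({\rm GR}(4,r),n)$ denote the numbers of cyclic codes, Euclidean self-dual cyclic codes, and (for $r$ even) Hermitian self-dual cyclic codes of length $n$ over ${\rm GR}(4,r)$. For $0\le h\le m-1$, $S_2(h)=\{h2^{i}\bmod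 m\mid i\ge0\}$ is the $2$-cyclotomic coset of $h$ modulo $m$ and $m_h=|S_2(h)|$. It is self-inverse if $S_2(-h)=S_2(h)$ (elements taken modulo $m$). $I_1$ is the union of all self-inverse cosets other than $\{0\}$ (for $h\in I_1$, $m_h$ is even); $I_2=\{0,\dots,m-1\}\setminus(\{0\}\cup I_1)$. $J_1,J_2$ are complete sets of representatives of the $2$-cyclotomic cosets in $I_1,I_2$, with $J_2$ chosen so that $h\in J_2$ iff $-h\in J_2$ (modulo $m$). $J_2$ is written as a disjoint union $J_2=J_2'\cup J_2''$ with $J_2''=\{-h\mid h\in J_2'\}$. *)

(* Defs.v *)
From HB Require Import structures.
From mathcomp Require Import all_boot all_order all_algebra all_fingroup.
From mathcomp Require Import all_solvable all_field qpoly.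

Set Implicit Arguments.
Unset Strict Implicit.
Unset Printing Implicit Defensive.

Import GRing.Theory.
Local Open Scope ring_scope.

(* Reduction modulo 2; 'F_2 is 'I_2. *)
Definition red2 (x : 'Z_4) : 'F_2 := inZp x.

Definition basic_irreducible (r : nat) (f : {poly 'Z_4}) : bool :=
  [&& f \is monic, size f == r.+1 & irreducibleb (map_poly red2 f)].

Lemma irreducible_F2_exists (r : nat) :
  (0 < r)%N -> exists g : {poly 'F_2},
    [/\ g \is monic, size g = r.+1 & irreducible_poly g].
Proof.
move=> r_gt0; have [K charK cardK] := pPrimePowerField (isT : prime 2) r_gt0.
pose L : splittingFieldType 'F_2 := pPrimeCharType charK.
have dimL : \dim {:L} = r.
  rewrite pprimeChar_dimf cardK.
  by rewrite pfactorK.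
have /cyclicP[z genz] := field_unit_group_cyclic [set: {unit K}].
pose x : L := val z.
have fullx : <<1; x>>%VS = {:L}%VS.
  apply/eqP; rewrite eqEsubv subvf /=; apply/subvP => y _.
  have [->|y0] := eqVneq (y : K) 0; first exact: mem0v.
  have uy : (y : K) \is a GRing.unit by rewrite unitfE.
  have : FinRing.unit K uy \in <[z]>%g by rewrite -genz inE.
  case/cycleP => i yi.
  have -> : y = x ^+ i.
    by rewrite /x; have /(congr1 val) := yi; rewrite /= FinRing.val_unitX.
  by rewrite rpredX // memv_adjoin.
have szx : size (minPoly 1 x) = r.+1.
  rewrite size_minPoly; congr _.+1.
  by have := dim_Fadjoin 1 x; rewrite fullx dimL dimv1 muln1.
have /polyOver1P[g gE] := minPolyOver 1 x.
have szg : size g = r.+1 by rewrite -szx gE size_map_poly.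
exists g; split => //.
  by rewrite -(map_monic (in_alg L)) -gE monic_minPoly.
split=> [|q sq1 qg]; first by rewrite szg.
have qov : map_poly (in_alg L) q \is a polyOver 1%VS.
  by apply/polyOver1P; exists q.
have qdv : map_poly (in_alg L) q %| minPoly 1 x by rewrite gE dvdp_map.
have := minPoly_irr qov qdv.
rewrite gE eqp_map => /orP[//|].
by rewrite -size_poly_eq1 size_map_poly (negPf sq1).
Qed.

Lemma basic_irreducible_exists (r : nat) :
  exists f : {poly 'Z_4}, (0 < r)%N ==> basic_irreducible r f.
Proof.
have [->|r_gt0] := posnP r; first by exists 0.
have [g [mg sg ig]] := irreducible_F2_exists r_gt0.
pose lift (x : 'F_2) : 'Z_4 := inZp x.
have lift0 : lift 0 = 0 by apply/val_inj.
have lift1 : lift 1 = 1 by apply/val_inj.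
have liftK : cancel lift red2 by case=> [[|[|k]] hk] //; apply/val_inj.
have red20 : red2 0 = 0 by apply/val_inj.
have g1 : lift (lead_coef g) = 1 by rewrite (monicP mg).
have sz : size (map_poly lift g) = r.+1.
  by rewrite -sg size_poly_eq // -lead_coefE g1 oner_eq0.
exists (map_poly lift g); apply/and3P; split.
- by rewrite monicE lead_coefE sz -{1}sg /= coef_map_id0 // sg -[r in _`_r]/(r.+1.-1) -sg -lead_coefE g1.
- by rewrite sz.
- suff -> : map_poly red2 (map_poly lift g) = g by apply/irreducibleP.
  by apply/polyP => i; rewrite !coef_map_id0 ?liftK.
Qed.

(* A fixed choice of the modulus; GR(4, r) does not depend on it up to
   isomorphism.  For r = 0 the polynomial is unspecified. *)
Definition gr4_poly (r : nat) : {poly 'Z_4} := xchoose (basic_irreducible_exists r).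

Lemma gr4_polyP (r : nat) : (0 < r)%N -> basic_irreducible r (gr4_poly r).
Proof. by move=> r0; apply: (implyP (xchooseP (basic_irreducible_exists r))). Qed.

Definition GR4 (r : nat) : Type := {poly %/ gr4_poly r}.
HB.instance Definition _ r := Finite.on (GR4 r).
HB.instance Definition _ r := GRing.ComNzRing.on (GR4 r).

(* The Teichmueller set does not depend on which element of order 2 ^ r - 1
   is taken for xi. *)
Definition teich_gen (r : nat) : GR4 r :=
  odflt 1 [pick xi : GR4 r | (2 ^ r).-1.-primitive_root xi].

Definition teichmuller (r : nat) : {set GR4 r} :=
  0 |: [set teich_gen r ^+ i | i : 'I_(2 ^ r).-1].

(* The pair (a, b) is unique when r > 0; the map is meant for r even. *)
Definition gr4_bar (r : nat) (x : GR4 r) : GR4 r :=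
  if [pick ab : GR4 r * GR4 r | [&& ab.1 \in teichmuller r,
        ab.2 \in teichmuller r & x == ab.1 + 2%:R * ab.2]] is Some ab
  then ab.1 ^+ (2 ^ r./2) + 2%:R * ab.2 ^+ (2 ^ r./2) else x.

(* (c_0, ..., c_{n-1}) |-> (c_{n-1}, c_0, ..., c_{n-2}) *)
Definition cyclic_shift (R : finComNzRingType) (n : nat) (u : 'rV[R]_n) :
    'rV[R]_n :=
  \row_i u 0 (ord_pred i).

(* Boolean form of submod_closed, so that codes can be counted. *)
Definition submodule (R : finComNzRingType) (n : nat) (C : {set 'rV[R]_n}) :
    bool :=
  (0 \in C) && [forall c : R, forall u in C, forall v in C, c *: u + v \in C].

Lemma submoduleP (R : finComNzRingType) (n : nat) (C : {set 'rV[R]_n}) :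
  reflect (submod_closed [in C]) (submodule C).
Proof.
apply: (iffP andP) => -[C0 lin]; split=> //.
  by move=> c u v uC vC; move/forallP/(_ c)/forall_inP/(_ u uC)/forall_inP: lin; apply.
by apply/forallP=> c; apply/forall_inP=> u uC; apply/forall_inP=> v; apply: lin.
Qed.

Definition cyclic_code (R : finComNzRingType) (n : nat) (C : {set 'rV[R]_n}) :
    bool :=
  submodule C && [forall u in C, cyclic_shift u \in C].

Definition euclid_dual (R : finComNzRingType) (n : nat) (C : {set 'rV[R]_n}) :
    {set 'rV[R]_n} :=
  [set v : 'rV[R]_n | [forall u in C, \sum_i u 0 i * v 0 i == 0]].

Definition hermitian_dual (r n : nat) (C : {set 'rV[GR4 r]_n}) :
    {set 'rV[GR4 r]_n} :=
  [set v : 'rV[GR4 r]_n |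
    [forall u in C, \sum_i u 0 i * gr4_bar (v 0 i) == 0]].

Definition num_cyclic (R : finComNzRingType) (n : nat) : nat :=
  #|[set C : {set 'rV[R]_n} | cyclic_code C]|.

Definition num_euclid_self_dual (R : finComNzRingType) (n : nat) : nat :=
  #|[set C : {set 'rV[R]_n} | cyclic_code C & C == euclid_dual C]|.

Definition num_hermitian_self_dual (r n : nat) : nat :=
  #|[set C : {set 'rV[GR4 r]_n} | cyclic_code C & C == hermitian_dual C]|.

(* The exponents i < m already give the whole coset, see coset2P. *)
Definition coset2 (m h : nat) : {set 'I_m} :=
  [set k : 'I_m | [exists i : 'I_m, k == h * 2 ^ i %% m :> nat]%N].

Lemma coset2P (m h : nat) (k : 'I_m) :
  reflect (exists i : nat, k = h * 2 ^ i %% m :> nat)%N (k \in coset2 m h).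
Proof.
rewrite inE; apply: (iffP existsP) => [[i /eqP ->]|]; first by exists i.
case=> i; have [j] := ubnP i; elim: j => // j IHj in i *.
rewrite ltnS => le_ij kE; have m_gt0 := leq_ltn_trans (leq0n k) (ltn_ord k).
have [lt_im|le_mi] := ltnP i m; first by exists (Ordinal lt_im); apply/eqP.
pose f (e : 'I_m.+1) : 'I_m := Ordinal (ltn_pmod (h * 2 ^ e) m_gt0).
have /injectivePn[x [y neq_xy fxy]] : ~~ injectiveb f.
  by apply/negP => /injectiveP/leq_card; rewrite !card_ord ltnn.
wlog lt_xy : x y neq_xy fxy / (x < y)%N.
  move=> W; case: (ltngtP x y) => [|lt_yx|/val_inj eq_xy]; first exact: W.
    by apply: (W y x) => //; rewrite eq_sym.
  by rewrite eq_xy eqxx in neq_xy.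
have le_yi : (y <= i)%N by rewrite (leq_trans _ le_mi) // -ltnS.
apply: (IHj (x + (i - y))%N).
  by rewrite (leq_trans _ le_ij) // -{2}(subnKC le_yi) ltn_add2r.
rewrite kE -{1}(subnKC le_yi) !expnD !mulnA -modnMml.
by move/(congr1 val): fxy => /= <-; rewrite modnMml.
Qed.

Definition opp_mod (m : nat) (h : 'I_m) : 'I_m :=
  Ordinal (ltn_pmod (m - h) (leq_ltn_trans (leq0n h) (ltn_ord h))).

Definition self_inverse (m : nat) (h : 'I_m) : bool :=
  coset2 m (opp_mod h) == coset2 m h.

Definition I1 (m : nat) : {set 'I_m} :=
  \bigcup_(h : 'I_m | self_inverse h && (coset2 m h != coset2 m 0)) coset2 m h.

Definition I2 (m : nat) : {set 'I_m} := ~: (coset2 m 0 :|: I1 m).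

Definition coset_reps (m : nat) (J I : {set 'I_m}) : bool :=
  is_transversal J [set coset2 m (val h) | h in I] I.

(* Main.v *)
(* Put N = 2^a. For each exponent h choose a root of unity om_h in GR(4, m_h) lifting w^h, where w
   is a primitive m-th root of unity in a large finite field of characteristic 2. The transforms
   X |-> om_h Y from Z_4[X]/(X^n - 1) to GR(4, m_h)[Y]/(Y^N - 1), one for each 2-cyclotomic coset,
   are jointly bijective, and the pairing of the transforms of u at h and of v at -h is a Fourier
   transform of the pairings of v with the shifts of u. Hence a self-dual cyclic code C is
   determined by its images C_h for h in {0}, J_1 and J_2', as the set of words whose transforms
   at h and at -h lie in C_h and in the dual of C_h. For h in J_2' the image C_h is an arbitrary
   cyclic code, because codes over Galois rings are equal to their double duals (a character
   sum). For h = 0 or h in J_1 the transforms at h and -h are related by the conjugation of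
   GR(4, m_h), which sends om_h to its inverse, and C_h has to be self-dual for the corresponding
   Euclidean or Hermitian form. *)
From HB Require Import structures.
Require Import Defs.
From mathcomp Require Import all_boot all_order all_algebra.
From mathcomp Require Import cyclic finfield algC qpoly qfpoly zify ring.

Set Implicit Arguments.
Unset Strict Implicit.
Unset Printing Implicit Defensive.

Import GRing.Theory Num.Theory.
Local Open Scope ring_scope.

Definition add_ord (n : nat) (k : 'I_n) (d : nat) : 'I_n :=
  Ordinal (ltn_pmod (k + d) (leq_ltn_trans (leq0n k) (ltn_ord k))).

Lemma iter_cyclic_shift_add (R : finComNzRingType) n d (y : 'rV[R]_n) (j : 'I_n) :
  iter d (@cyclic_shift _ n) y 0 (add_ord j d) = y 0 j.
Proof.
elim: d => [|d IH] /=; first by congr (y 0 _); apply/val_inj; rewrite /= addn0 modn_small.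
rewrite mxE -[RHS]IH; suff -> : add_ord j d.+1 = ordS (add_ord j d) by rewrite ordSK.
by apply/val_inj; rewrite /= -[(_ %% _).+1]addn1 modnDml addnS addn1.
Qed.

Lemma iter_cyclic_shift (R : finComNzRingType) n d (y : 'rV[R]_n) (j : 'I_n) :
  (n %| d)%N -> iter d (@cyclic_shift _ n) y 0 j = y 0 j.
Proof.
move=> dn; rewrite -[RHS](iter_cyclic_shift_add d).
suff -> : add_ord j d = j by []; apply/val_inj => /=.
by case/dvdnP: dn => q ->; rewrite addnC modnMDl modn_small.
Qed.

(** * Duality of codes over rings with a generating character *)

Section Codes.
Variables (R : finComNzRingType) (p : nat).
Implicit Types (C : {set 'rV[R]_p}) (u v : 'rV[R]_p).

Definition dot u v := \sum_i u 0 i * v 0 i.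

Lemma dotDl u u' v : dot (u + u') v = dot u v + dot u' v.
Proof. by rewrite -big_split; apply: eq_bigr => i _; rewrite mxE mulrDl. Qed.

Lemma dotZl c u v : dot (c *: u) v = c * dot u v.
Proof. by rewrite mulr_sumr; apply: eq_bigr => i _; rewrite mxE mulrA. Qed.

Lemma dotC u v : dot u v = dot v u.
Proof. by apply: eq_bigr => i _; rewrite mulrC. Qed.

Lemma dot_shift u v : dot (cyclic_shift u) (cyclic_shift v) = dot u v.
Proof.
have bij : bijective (@ord_pred p).
  by exists (@ordS p); [exact: ord_predK | exact: ordSK].
rewrite [RHS](reindex (@ord_pred p)) /=; last exact: onW_bij.
by apply: eq_bigr => i _; rewrite !mxE.
Qed.

Lemma euclid_dualP C v :
  reflect (forall u, u \in C -> dot u v = 0) (v \in euclid_dual C).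
Proof.
rewrite inE; apply: (iffP forall_inP) => H u uC; first exact/eqP/H.
exact/eqP/H.
Qed.

Lemma euclid_dual_submodule C : submodule (euclid_dual C).
Proof.
apply/submoduleP; split=> [|c u v /euclid_dualP uC /euclid_dualP vC]; apply/euclid_dualP => x xC.
  by apply: big1 => i _; rewrite mxE mulr0.
by rewrite dotC dotDl dotZl ![dot _ x]dotC uC // vC // mulr0 addr0.
Qed.

Lemma cyclic_code_iter C d u : cyclic_code C -> u \in C ->
  iter d (@cyclic_shift _ p) u \in C.
Proof.
case/andP=> _ /forall_inP Csh uC; elim: d => // d IH; exact: Csh.
Qed.

Lemma euclid_dual_cyclic C : cyclic_code C -> cyclic_code (euclid_dual C).
Proof.
move=> cC; apply/andP; split; first exact: euclid_dual_submodule.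
apply/forall_inP => v /euclid_dualP vC; apply/euclid_dualP => u uC.
have -> : u = cyclic_shift (iter p.-1 (@cyclic_shift _ p) u).
  apply/rowP => i; rewrite -iterS prednK ?(leq_ltn_trans _ (ltn_ord i)) //.
  by rewrite iter_cyclic_shift.
by rewrite dot_shift vC ?cyclic_code_iter.
Qed.

Lemma submoduleZ C c u : submodule C -> u \in C -> c *: u \in C.
Proof. by case/submoduleP=> C0 Clin uC; rewrite -[_ *: _]addr0 Clin. Qed.

Lemma submoduleD C u v : submodule C -> u \in C -> v \in C -> u + v \in C.
Proof. by case/submoduleP=> C0 Clin uC vC; rewrite -[u]scale1r Clin. Qed.

Lemma submodule_sum C I (s : seq I) (P : pred I) (F : I -> 'rV[R]_p) : submodule C ->
  (forall i, P i -> F i \in C) -> \sum_(i <- s | P i) F i \in C.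
Proof.
move=> sC FC; elim/big_rec: _ => [|i x Pi xC]; first by case/submoduleP: sC.
by apply: submoduleD => //; apply: FC.
Qed.

Variable f : R -> 'Z_4.
Hypothesis fD : {morph f : x y / x + y}.
Hypothesis f2 : f 2%:R = 2%:R.
Hypothesis div2 : forall x : R, x != 0 -> exists y, y * x = 2%:R.

(** An additive character with [chi 2 = -1]; by [div2] every nonzero ideal contains 2, so it is
    nontrivial on each of them. *)
Let chi (x : R) : algC := 'i ^+ f x.

Let chiD x y : chi (x + y) = chi x * chi y.
Proof.
have i4 : 'i ^+ 4 = 1 :> algC by rewrite -[4%N]/(2 * 2)%N exprM sqrCi sqrrN expr1n.
by rewrite /chi fD /= (expr_mod _ i4) exprD.
Qed.

Let chi0 : chi 0 = 1.
Proof.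
have f0 : f 0 = 0 by apply: (addrI (f 0)); rewrite -fD !addr0.
by rewrite /chi f0 expr0.
Qed.

Let chi2 : chi 2%:R = -1.
Proof. by rewrite /chi f2 -sqrCi. Qed.

(* Translation by [u1] negates the sum because [chi 2 = -1]. *)
Let sum_chi0 C (g : 'rV[R]_p -> R) u1 : {morph g : u v / u + v} -> g u1 = 2%:R ->
  submodule C -> u1 \in C -> \sum_(u in C) chi (g u) = 0.
Proof.
move=> gD g1 sC u1C; set S := \sum_(u in C) _.
have : S = - S.
  rewrite -mulrN1 -chi2 -g1 mulr_suml {1}/S (reindex_inj (addIr u1)) /=.
  apply: eq_big => [u|u _]; last by rewrite gD chiD.
  apply/idP/idP => [uC|uC]; last exact: submoduleD.
  rewrite -[u](addrK u1); apply: submoduleD => //.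
  by rewrite -scaleN1r; apply: submoduleZ.
by move/eqP; rewrite -subr_eq0 opprK -mulr2n -mulr_natr mulf_eq0 pnatr_eq0 orbF => /eqP.
Qed.

(** Sum [chi (dot u v)] over [u] in [C] and all [v] in both orders: the sum over [u] is [#|C|] or 0
    according to whether [v] lies in the dual, while the sum over [v] vanishes unless [u = 0]. *)
Lemma card_euclid_dual C : submodule C -> (#|C| * #|euclid_dual C| = #|[set: 'rV[R]_p]|)%N.
Proof.
move=> sC; apply/eqP; rewrite -(@eqr_nat algC) natrM; apply/eqP.
transitivity (\sum_(v in [set: 'rV[R]_p]) \sum_(u in C) chi (dot u v)).
  rewrite [RHS](bigID (mem (euclid_dual C))) /= [X in _ + X]big1 ?addr0; last first.
    move=> v /andP[_]; rewrite inE negb_forall => /existsP[u].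
    rewrite negb_imply => /andP[uC /div2[y yE]].
    apply: (sum_chi0 (u1 := y *: u)) => //; last exact: submoduleZ.
    - by move=> u' v'; rewrite dotDl.
    - by rewrite dotZl.
  rewrite (eq_bigr (fun=> #|C|%:R)) => [|v /andP[_ /euclid_dualP vC]].
    rewrite sumr_const -[RHS]mulr_natr; congr (_ * _%:R).
    by apply: eq_card => v; rewrite [RHS]unfold_in /= in_setT.
  rewrite (eq_bigr (fun=> 1)) => [|u uC]; last by rewrite vC // chi0.
  by rewrite sumr_const.
rewrite exchange_big /= (bigD1 0) /=; last by case/submoduleP: sC.
rewrite (eq_bigr (fun=> 1)) => [|v _]; last first.
  by rewrite -(scale0r v) dotZl mul0r chi0.
rewrite sumr_const big1 ?addr0 // => u /andP[_ u0].
have /existsP[i ui] : [exists i, u 0 i != 0].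
  apply: contraNT u0; rewrite negb_exists => /forallP u0.
  by apply/eqP/rowP => i; rewrite mxE; apply/eqP; have := u0 i; rewrite negbK.
have [y yE] := div2 ui.
apply: (sum_chi0 (g := dot u) (u1 := y *: delta_mx 0 i)) => //.
- by move=> v v'; rewrite !(dotC u) dotDl.
- rewrite dotC dotZl /dot (bigD1 i) //= mxE !eqxx mul1r big1 ?addr0 // => j ji.
  by rewrite mxE (negPf ji) andbF mul0r.
- by apply/submoduleP; split=> [|c v v' _ _]; rewrite inE.
- by rewrite inE.
Qed.

(** [C] lies in its double dual, and [card_euclid_dual] for [C] and for its dual shows that the
    sizes agree. *)
Lemma euclid_dualK C : submodule C -> euclid_dual (euclid_dual C) = C.
Proof.
move=> sC; apply/esym/eqP; rewrite eqEcard; apply/andP; split.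
  apply/subsetP => u uC; apply/euclid_dualP => v /euclid_dualP vC.
  by rewrite dotC vC.
have pos : (0 < #|euclid_dual C|)%N.
  by apply/card_gt0P; exists 0; case/submoduleP: (euclid_dual_submodule C).
rewrite -(leq_pmul2l pos) card_euclid_dual ?euclid_dual_submodule //.
by rewrite -(card_euclid_dual sC) mulnC.
Qed.

End Codes.

(** * The Fourier transform on the odd part of the length *)

Lemma big_add_ord (R : nmodType) (n m N : nat) (l : 'I_n) (F : 'I_n -> R) :
  n = (m * N)%N ->
  \sum_(k < n | (k %% N == l %% N)%N) F k = \sum_(s < m) F (add_ord l (N * s)).
Proof.
move=> nE; have n_gt0 : (0 < n)%N := leq_ltn_trans (leq0n l) (ltn_ord l).
have [N_gt0 m_gt0] : (0 < N)%N /\ (0 < m)%N.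
  by apply/andP; rewrite andbC -muln_gt0 -nE.
have dNn : (N %| n)%N by rewrite nE dvdn_mull.
(* The inverse of [s |-> l + N * s] modulo [n]; adding [n - l] replaces a subtraction of [l], which
   could truncate. *)
pose f (k : 'I_n) : 'I_m := Ordinal (ltn_pmod ((k + (n - l)) %/ N) m_gt0).
rewrite (reindex_onto (fun s : 'I_m => add_ord l (N * s)) f) /=; last first.
  move=> k /eqP kl; apply/val_inj => /=.
  have lt_ln := ltn_ord l.
  have dN : (N %| k + (n - l))%N.
    rewrite /dvdn -[X in _ == X](mod0n N) -(eqn_modDl l) addn0.
    have -> : (l + (k + (n - l)) = k + n)%N by lia.
    by rewrite -modnDmr (eqP dNn) addn0 kl.
  rewrite muln_modr mulnC divnK // (mulnC N) -nE modnDmr.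
  have -> : (l + (k + (n - l)) = k + n)%N by lia.
  by rewrite modnDr modn_small.
apply: eq_bigl => s; rewrite modn_dvdm //.
rewrite (mulnC N) addnC modnMDl eqxx /=; apply/eqP/val_inj => /=.
have lt_ln := ltn_ord l; have lt_sm := ltn_ord s.
have lt_sn : (N * s < n)%N by rewrite nE mulnC ltn_pmul2r.
rewrite (mulnC s).
have [lt_n|le_n] := ltnP (l + N * s) n.
  rewrite (modn_small lt_n) addnC.
  have -> : (n - l + (l + N * s) = N * (m + s))%N by rewrite mulnDr (mulnC N m) -nE; lia.
  by rewrite mulKn // modnDl modn_small.
have -> : ((l + N * s) %% n = l + N * s - n)%N.
  by rewrite -{1}(subnK le_n) modnDr modn_small //; lia.
have -> : (l + N * s - n + (n - l) = N * s)%N by lia.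
by rewrite mulKn // modn_small.
Qed.

(** A ring morphism only when 4 = 0 in [B], hence not declared as one. *)
Definition of_Z4 (B : pzRingType) (c : 'Z_4) : B := (nat_of_ord c)%:R.
Arguments of_Z4 {B} c.

Section Char4.
Variables (B : comNzRingType) (B4 : 4%:R = 0 :> B).

Lemma natr_mod4 k : (k %% 4)%:R = k%:R :> B.
Proof. by rewrite [in RHS](divn_eq k 4) natrD natrM B4 mulr0 add0r. Qed.

Lemma of_Z4D (c d : 'Z_4) : of_Z4 (c + d) = of_Z4 c + of_Z4 d :> B.
Proof. by rewrite /of_Z4 /= natr_mod4 natrD. Qed.

Lemma of_Z4M (c d : 'Z_4) : of_Z4 (c * d) = of_Z4 c * of_Z4 d :> B.
Proof. by rewrite /of_Z4 /= natr_mod4 natrM. Qed.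

Lemma of_Z4_sum I (s : seq I) (P : pred I) (F : I -> 'Z_4) :
  of_Z4 (\sum_(i <- s | P i) F i) = \sum_(i <- s | P i) of_Z4 (F i) :> B.
Proof. by elim/big_rec2: _ => // i x y _ <-; rewrite of_Z4D. Qed.

(** Squaring turns congruences modulo 2 into equalities; this device lifts idempotents, inverses and
    Teichmueller representatives from the residue field. *)
Lemma sqr_eq_mod2 (a b c : B) : a = b + c *+ 2 -> a ^+ 2 = b ^+ 2.
Proof.
move=> ->; have -> : (b + c *+ 2) ^+ 2 = b ^+ 2 + 4%:R * (b * c + c ^+ 2) by ring.
by rewrite B4 mul0r addr0.
Qed.

End Char4.

Section Fourier.
Variables (B : finComNzRingType) (B4 : 4%:R = 0 :> B).
Variables (m N n : nat) (nE : n = (m * N)%N) (n_gt0 : (0 < n)%N).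
Implicit Types (u v : 'rV['Z_4]_n) (om : B).

Definition fourier om u : 'rV[B]_N :=
  \row_j \sum_(k < n | (k %% N == j)%N) of_Z4 (u 0 k) * om ^+ k.

Lemma fourier0 om : fourier om 0 = 0.
Proof. by apply/rowP=> j; rewrite !mxE big1 // => k _; rewrite mxE mul0r. Qed.

Lemma fourierD om u v : fourier om (u + v) = fourier om u + fourier om v.
Proof.
apply/rowP=> j; rewrite !mxE -big_split /=; apply: eq_bigr => k _.
by rewrite !mxE of_Z4D // mulrDl.
Qed.

Lemma fourierZ om (c : 'Z_4) u : fourier om (c *: u) = of_Z4 c *: fourier om u.
Proof.
apply/rowP=> j; rewrite !mxE mulr_sumr; apply: eq_bigr => k _.
by rewrite !mxE of_Z4M // mulrA.
Qed.

Lemma fourier_sum om I (s : seq I) (P : pred I) (F : I -> 'rV['Z_4]_n) :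
  fourier om (\sum_(i <- s | P i) F i) = \sum_(i <- s | P i) fourier om (F i).
Proof.
elim/big_rec2: _ => [|i x y _ <-]; first exact: fourier0.
exact: fourierD.
Qed.

Lemma N_gt0 : (0 < N)%N. Proof. by move: n_gt0; rewrite nE muln_gt0 => /andP[]. Qed.

(* The transform is X |-> om * Y from Z_4[X]/(X^n - 1) to B[Y]/(Y^N - 1). *)
Lemma fourier_shift om u : om ^+ m = 1 ->
  fourier om (cyclic_shift u) = om *: cyclic_shift (fourier om u).
Proof.
move=> om1; have omn : om ^+ n = 1 by rewrite nE exprM om1 expr1n.
have bij : bijective (@ordS n).
  by exists (@ord_pred n); [exact: ordSK | exact: ord_predK].
apply/rowP=> j; rewrite !mxE mulr_sumr (reindex (@ordS n)) /=; last exact: onW_bij.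
apply: eq_big => [k|k _]; last first.
  by rewrite mxE ordSK expr_mod // exprS; ring.
rewrite modn_dvdm; last by rewrite [n in (_ %| n)%N]nE dvdn_mull.
have eqj : (j == ordS (ord_pred j) :> nat) by rewrite ord_predK.
rewrite {1}(eqP eqj) /= -[(k.+1)%N]addn1 -[((j + N).-1 %% N).+1%N]addn1.
by rewrite eqn_modDr modn_mod.
Qed.

Lemma fourier_iter_shift om d u : om ^+ m = 1 ->
  fourier om (iter d (@cyclic_shift _ n) u) = om ^+ d *: iter d (@cyclic_shift _ N) (fourier om u).
Proof.
move=> om1; elim: d => [|d IH]; first by rewrite scale1r.
rewrite !iterS fourier_shift // IH exprS -scalerA; congr (_ *: _).
by apply/rowP=> j; rewrite !mxE.
Qed.

Lemma fourier_iterN om s u : om ^+ m = 1 ->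
  fourier om (iter (N * s) (@cyclic_shift _ n) u) = om ^+ (N * s) *: fourier om u.
Proof.
move=> om1; rewrite fourier_iter_shift //; congr (_ *: _).
by apply/rowP=> j; rewrite iter_cyclic_shift // dvdn_mulr.
Qed.

Lemma fourierE om u (l : 'I_n) (j : 'I_N) : om ^+ m = 1 -> j = (l %% N)%N :> nat ->
  fourier om u 0 j = om ^+ l * \sum_(s < m) of_Z4 (u 0 (add_ord l (N * s))) * om ^+ (N * s).
Proof.
move=> om1 jl; have omn : om ^+ n = 1 by rewrite nE exprM om1 expr1n.
rewrite mxE jl (big_add_ord _ _ nE) mulr_sumr; apply: eq_bigr => s _ /=.
by rewrite expr_mod // exprD; ring.
Qed.

(** [om ^+ m.-1] is the inverse of [om], so within a residue class modulo [N] the powers [om ^+ k]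
    cancel and only those of the relative shift [N * s] remain. *)
Lemma fourier_dot om u v : om ^+ m = 1 ->
  dot (fourier om u) (fourier (om ^+ m.-1) v) =
  \sum_(s < m) of_Z4 (\sum_k u 0 (add_ord k (N * s)) * v 0 k) * om ^+ (N * s).
Proof.
move=> om1; have m_gt0 : (0 < m)%N by move: n_gt0; rewrite nE muln_gt0 => /andP[].
have omV k : om ^+ k * (om ^+ m.-1) ^+ k = 1.
  by rewrite -exprMn -exprS prednK // om1 expr1n.
rewrite /dot; transitivity (\sum_(k < n) of_Z4 (v 0 k) *
    \sum_(s < m) of_Z4 (u 0 (add_ord k (N * s))) * om ^+ (N * s)).
  pose p (k : 'I_n) : 'I_N := Ordinal (ltn_pmod k N_gt0).
  rewrite [RHS](partition_big p xpredT) //=; apply: eq_bigr => j _.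
  rewrite [X in _ * X]mxE mulr_sumr; apply: eq_big => [k|k /eqP kj].
    by rewrite -val_eqE.
  rewrite (fourierE _ (l := k)) //.
  set S := \sum_(s < m) _; rewrite mulrC -mulrA; congr (_ * _).
  by rewrite mulrA [_ * om ^+ k]mulrC omV mul1r.
under eq_bigr do rewrite mulr_sumr.
rewrite exchange_big /=; apply: eq_bigr => s _; rewrite of_Z4_sum // mulr_suml.
by apply: eq_bigr => k _; rewrite of_Z4M // mulrCA mulrA.
Qed.

End Fourier.

(** * Cyclotomic cosets *)

Section Cosets.
Variables (m : nat) (odd_m : odd m).
Implicit Types h k l : 'I_m.

Definition dbl h : 'I_m :=
  Ordinal (ltn_pmod (h * 2) (leq_ltn_trans (leq0n h) (ltn_ord h))).

Lemma val_iter_dbl i h : iter i dbl h = (h * 2 ^ i %% m)%N :> nat.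
Proof.
elim: i => [|i IH]; first by rewrite expn0 muln1 modn_small.
by rewrite iterS /= IH modnMml expnSr mulnA.
Qed.

Lemma dbl_inj : injective dbl.
Proof.
move=> h k /(congr1 val) /= hk; apply/val_inj => /=.
(* For odd [m], [uphalf m] is the inverse of 2 modulo [m]. *)
have : (h * 2 * (uphalf m) = k * 2 * (uphalf m) %[mod m])%N.
  by rewrite -modnMml hk modnMml.
have E : (2 * uphalf m = m.+1)%N by rewrite uphalf_half odd_m; lia.
by rewrite -!mulnA E !mulnS ![(_ + _ * m)%N]addnC !modnMDl !modn_small.
Qed.

(** Cosets become orbits of the permutation [dbl], so that [findex] and [order] apply to them. *)
Lemma coset2E h k : (k \in coset2 m h) = fconnect dbl h k.
Proof.
apply/coset2P/idP => [[i kE]|/iter_findex <-].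
  have -> : k = iter i dbl h by apply/val_inj; rewrite /= val_iter_dbl.
  exact: fconnect_iter.
by exists (findex dbl h k); rewrite val_iter_dbl.
Qed.

Lemma mem_coset2 h : h \in coset2 m h.
Proof. by rewrite coset2E connect0. Qed.

Lemma coset2_eqP h k : reflect (coset2 m h = coset2 m k) (k \in coset2 m h).
Proof.
rewrite coset2E; apply: (iffP idP) => [hk|E].
  by apply/setP=> l; rewrite !coset2E (same_connect (fconnect_sym dbl_inj) hk).
by rewrite -coset2E E mem_coset2.
Qed.

Lemma coset2_sym h k : (k \in coset2 m h) = (h \in coset2 m k).
Proof. by rewrite !coset2E (fconnect_sym dbl_inj). Qed.

Lemma card_coset2 h : #|coset2 m h| = fingraph.order dbl h.
Proof. by apply: eq_card => k; rewrite coset2E. Qed.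

Lemma coset2_gt0 h : (0 < #|coset2 m h|)%N.
Proof. by apply/card_gt0P; exists h; rewrite mem_coset2. Qed.

Lemma coset2_le h : (#|coset2 m h| <= m)%N.
Proof. by rewrite -[X in (_ <= X)%N]card_ord max_card. Qed.

Lemma coset2_period h : (h * 2 ^ #|coset2 m h| = h %[mod m])%N.
Proof.
by rewrite card_coset2 -val_iter_dbl (iter_order dbl_inj) modn_small.
Qed.

Lemma opp_modK : involutive (@opp_mod m).
Proof.
move=> h; apply/val_inj => /=; have hm := ltn_ord h.
have [->|h0] := posnP h; first by rewrite subn0 modnn subn0 modnn.
by rewrite (modn_small (m := (m - h)%N)) ?subKn ?modn_small //; lia.
Qed.

Lemma opp_mod_dbl h : opp_mod (dbl h) = dbl (opp_mod h).
Proof.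
apply/val_inj => /=; have hm := ltn_ord h; rewrite modnMml.
have lt2 : ((h * 2) %% m < m)%N by apply: ltn_pmod; lia.
apply/eqP; rewrite -(eqn_modDr (h * 2 %% m)) subnK ?(ltnW lt2) //.
by rewrite modnn modnDmr -mulnDl subnK ?(ltnW hm) // modnMr.
Qed.

Lemma opp_mod_iter i h : opp_mod (iter i dbl h) = iter i dbl (opp_mod h).
Proof. by elim: i => // i IH; rewrite !iterS opp_mod_dbl IH. Qed.

Lemma coset2_opp h k : (opp_mod k \in coset2 m (opp_mod h)) = (k \in coset2 m h).
Proof.
suff imp h' k' : k' \in coset2 m h' -> opp_mod k' \in coset2 m (opp_mod h').
  by apply/idP/idP=> [/imp|/imp//]; rewrite !opp_modK.
by rewrite !coset2E => /iter_findex <-; rewrite opp_mod_iter fconnect_iter.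
Qed.

Lemma card_coset2_opp h : #|coset2 m (opp_mod h)| = #|coset2 m h|.
Proof.
rewrite -(card_imset _ (inv_inj opp_modK)); apply: eq_card => k.
rewrite -{1}[k]opp_modK mem_imset ?coset2_opp //.
exact: inv_inj opp_modK.
Qed.

End Cosets.

(** * Lifted roots of unity *)

Section Points.
Variables (L : finFieldType) (L2 : 2%:R = 0 :> L).
Variables (m : nat) (odd_m : odd m) (w : L) (w_prim : m.-primitive_root w).

(* A point over [h] is a copy of GR(4, m_h) with a lift of [w ^+ h] to an m-th root of unity.
   The functional is only there to provide a character of the additive group that is
   nontrivial on every nonzero ideal. *)
Record point (h : 'I_m) := Point {
  point_ring :> finComNzRingType;
  point_red : {rmorphism point_ring -> L};
  point_root : point_ring;
  point_char4 : 4%:R = 0 :> point_ring;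
  point_red0 : forall x, point_red x = 0 -> exists y, x = y *+ 2;
  point_tors : forall x : point_ring, x *+ 2 = 0 -> exists y, x = y *+ 2;
  point_card : #|point_ring| = (4 ^ #|coset2 m h|)%N;
  point_root1 : point_root ^+ m = 1;
  point_red_root : point_red point_root = w ^+ h;
  point_functional : exists f : point_ring -> 'Z_4,
    {morph f : x y / x + y} /\ f 2%:R = 2%:R }.

Lemma w_opp (h : 'I_m) : w ^+ opp_mod h = (w ^+ h) ^+ m.-1.
Proof.
rewrite /= (expr_mod _ (prim_expr_order w_prim)) -exprM; apply/eqP.
rewrite (eq_prim_root_expr w_prim) -(eqn_modDr h) subnK ?(ltnW (ltn_ord h)) //.
by rewrite -mulnSr prednK ?odd_gt0 // modnn modnMl.
Qed.

(* The point over [-h] shares its ring with the point over [h], so that the two transforms can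
   be paired. *)
Definition opp_point (h : 'I_m) (P : point h) : point (opp_mod h).
Proof.
refine (@Point (opp_mod h) P (point_red P) (point_root P ^+ m.-1)
  (point_char4 P) (@point_red0 _ P) (@point_tors _ P) _ _ _ (point_functional P)).
- by rewrite card_coset2_opp ?point_card.
- by rewrite exprAC point_root1 expr1n.
- by rewrite rmorphXn /= point_red_root w_opp.
Defined.

Lemma red_mul2 h (P : point h) (x : P) : point_red P (x *+ 2) = 0.
Proof. by rewrite rmorphMn /= -mulr_natr L2 mulr0. Qed.

Lemma natrL k : k%:R = (odd k)%:R :> L.
Proof.
by rewrite -[in LHS](odd_double_half k) -muln2 natrD natrM L2 mulr0 addr0.
Qed.

Lemma natrL_eq0 k : (k%:R == 0 :> L) = ~~ odd k.
Proof. by rewrite natrL; case: odd; rewrite ?eqxx ?oner_eq0. Qed.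

Lemma sqrrD2 (x y : L) : (x + y) ^+ 2 = x ^+ 2 + y ^+ 2.
Proof. by rewrite sqrrD -mulr_natr L2 mulr0 addr0. Qed.

Lemma natrL_sqr k : k%:R ^+ 2 = k%:R :> L.
Proof. by rewrite natrL; case: odd; rewrite ?expr0n ?expr1n. Qed.

Lemma sum_sqr I (s : seq I) (P : pred I) (F : I -> L) :
  (\sum_(i <- s | P i) F i) ^+ 2 = \sum_(i <- s | P i) F i ^+ 2.
Proof.
elim/big_rec2: _ => [|i x y _ <-]; first by rewrite expr0n.
by rewrite sqrrD2.
Qed.

Lemma horner_sqr d (c : 'I_d -> nat) (x : L) :
  \sum_(s < d) (c s)%:R * (x ^+ 2) ^+ s = (\sum_(s < d) (c s)%:R * x ^+ s) ^+ 2.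
Proof.
by rewrite sum_sqr; apply: eq_bigr => s _; rewrite [RHS]exprMn natrL_sqr exprAC.
Qed.

(** The coefficients lie in the prime field, so evaluation commutes with squaring and the zeros are
    stable under doubling the exponent. *)
Lemma horner_coset2 d (c : 'I_d -> nat) (h l : 'I_m) e : l \in coset2 m h ->
  \sum_(s < d) (c s)%:R * (w ^+ (h * e)) ^+ s = 0 ->
  \sum_(s < d) (c s)%:R * (w ^+ (l * e)) ^+ s = 0.
Proof.
rewrite coset2E => /iter_findex <-; move: (findex _ _ _) => i h0.
elim: i => // i IH; rewrite iterS; set k := iter _ _ _ in IH *.
have -> : w ^+ (dbl k * e) = (w ^+ (k * e)) ^+ 2.
  by rewrite exprM /= (expr_mod _ (prim_expr_order w_prim)) -!exprM; congr (_ ^+ _); lia.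
by rewrite horner_sqr IH expr0n.
Qed.

(** For [e] prime to [m] the roots [w ^+ (l * e)] are distinct, too many for a polynomial of degree
    below [d] unless all its coefficients vanish in characteristic 2. *)
Lemma odd_coef_roots d (c : 'I_d -> nat) e (A : {set 'I_m}) : coprime m e ->
  (forall l, l \in A -> \sum_(s < d) (c s)%:R * (w ^+ (l * e)) ^+ s = 0) ->
  (d <= #|A|)%N -> forall s, ~~ odd (c s).
Proof.
move=> cop A0 dA s; pose p : {poly L} := \poly_(i < d) (if insub i is Some j then (c j)%:R else 0).
have coefp (j : 'I_d) : p`_j = (c j)%:R by rewrite coef_poly ltn_ord valK.
suff p0 : p = 0 by rewrite -natrL_eq0 -coefp p0 coef0.
apply: (roots_geq_poly_eq0 (rs := [seq w ^+ (l * e) | l : 'I_m <- enum A])).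
- apply/allP=> _ /mapP[l + ->]; rewrite mem_enum => lA; rewrite /root.
  rewrite horner_poly -[X in _ == X](A0 l lA); apply/eqP.
  by apply: eq_bigr => j _; rewrite valK.
- rewrite map_inj_in_uniq ?enum_uniq // => k l _ _ /eqP.
  have we_prim : m.-primitive_root (w ^+ e).
    by rewrite (prim_root_exp_coprime _ w_prim) coprime_sym.
  rewrite ![(_ * e)%N]mulnC !exprM (eq_prim_root_expr we_prim) => /eqP.
  by rewrite !modn_small // => /val_inj.
- by rewrite size_map -cardE (leq_trans (size_poly _ _)).
Qed.

Lemma red_sum h (P : point h) d e (c : 'I_d -> nat) :
  point_red P (\sum_(s < d) (c s)%:R * point_root P ^+ (e * s)) =
  \sum_(s < d) (c s)%:R * (w ^+ (h * e)) ^+ s.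
Proof.
rewrite rmorph_sum; apply: eq_bigr => s _ /=.
by rewrite rmorphM rmorph_nat rmorphXn /= point_red_root -!exprM mulnA.
Qed.

(** Half of the vanishing sum is 2-torsion, hence a multiple of 2; this permits a second pass,
    modulo 4. *)
Lemma half_sum h (P : point h) d e (c : 'I_d -> nat) :
  (forall s, ~~ odd (c s)) ->
  \sum_(s < d) (c s)%:R * point_root P ^+ (e * s) = 0 ->
  point_red P (\sum_(s < d) (c s)./2%:R * point_root P ^+ (e * s)) = 0.
Proof.
move=> even0 S0; suff /point_tors[y ->] : (\sum_(s < d) (c s)./2%:R * point_root P ^+ (e * s)) *+ 2 = 0.
  exact: red_mul2.
rewrite -sumrMnl -[RHS]S0; apply: eq_bigr => s _; rewrite -mulrnAl -mulrnA muln2.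
by rewrite -[in RHS](odd_double_half (c s)) (negPf (even0 s)).
Qed.

Lemma dvdn4_half k : ~~ odd k -> ~~ odd k./2 -> (4 %| k)%N.
Proof. by move=> k0 k1; lia. Qed.

Lemma Z4_eq0 (c : 'Z_4) : (4 %| c)%N -> c = 0.
Proof. by move=> c4; apply/val_inj => /=; rewrite -(modn_small (ltn_ord c)); apply/eqP. Qed.

(* Reduction modulo 2 turns the hypothesis into a polynomial of degree less than m with m
   roots in [L]; applying this to [g] and then to half of [g] gives [g = 0] modulo 4. *)
Lemma fourier_joint_inj e (g : 'I_m -> 'Z_4) : coprime m e ->
  (forall l, exists h (P : point h), l \in coset2 m h /\
     \sum_(s < m) of_Z4 (g s) * point_root P ^+ (e * s) = 0) ->
  forall s, g s = 0.
Proof.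
move=> cop g0 s; apply: Z4_eq0.
have even0 : forall s, ~~ odd (g s).
  apply: (@odd_coef_roots _ (fun s => g s) e setT); rewrite ?cardsT ?card_ord //.
  move=> l _; have [h [P [lh S0]]] := g0 l; apply: horner_coset2 lh _.
  by rewrite -(red_sum P e (fun s => g s : nat)) [X in point_red _ X]S0 rmorph0.
apply: dvdn4_half => //.
apply: (@odd_coef_roots _ (fun s => (g s : nat)./2) e setT); rewrite ?cardsT ?card_ord //.
move=> l _; have [h [P [lh S0]]] := g0 l; apply: horner_coset2 lh _.
by rewrite -(red_sum P e (fun s => (g s : nat)./2)) (half_sum even0 S0).
Qed.

(** The first [r] powers already span: they give an injective map from [r]-tuples over ['Z_4] to a
    ring with the same number [4 ^ r] of elements. *)
Lemma point_span h (P : point h) e (b : P) : coprime m e ->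
  exists c : 'I_m -> 'Z_4, b = \sum_(s < m) of_Z4 (c s) * point_root P ^+ (e * s).
Proof.
move=> cop; set r := #|coset2 m h|.
pose f (c : {ffun 'I_r -> 'Z_4}) : P := \sum_(s < r) of_Z4 (c s) * point_root P ^+ (e * s).
have f_inj : injective f.
  move=> c c' cc'; apply/ffunP => s; apply/eqP; rewrite -subr_eq0; apply/eqP.
  pose d s : 'Z_4 := c s - c' s; rewrite -/(d s); apply: Z4_eq0.
  have d0 : \sum_(s < r) (d s : nat)%:R * point_root P ^+ (e * s) = 0 :> P.
    apply: (addIr (f c')); rewrite add0r -[in RHS]cc' -big_split /=; apply: eq_bigr => j _.
    rewrite -[(_)%:R]/(of_Z4 (d j)) -mulrDl -(of_Z4D (point_char4 P)); congr (of_Z4 _ * _).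
    by rewrite /d subrK.
  have even0 : forall s, ~~ odd (d s).
    apply: (@odd_coef_roots _ (fun s => d s) e (coset2 m h)) => // l lh.
    by apply: horner_coset2 lh _; rewrite -(red_sum P e (fun s => d s : nat)) d0 rmorph0.
  apply: dvdn4_half => //.
  apply: (@odd_coef_roots _ (fun s => (d s : nat)./2) e (coset2 m h)) => // l lh.
  apply: horner_coset2 lh _.
  by rewrite -(red_sum P e (fun s => (d s : nat)./2)) (half_sum even0 d0).
have /(_ b) : forall b, b \in codom f.
  by apply: inj_card_onto => //; rewrite card_ffun !card_ord point_card.
(* Coefficients beyond the first [r] are zero, so that the sum can run over ['I_m]. *)
case/codomP => c ->; exists (fun s => if insub (s : nat) is Some j then c j else 0).
rewrite /f -(subnKC (coset2_le h)) -/r big_split_ord /= [X in _ + X]big1 ?addr0.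
  by apply: eq_bigr => s _; rewrite /= valK.
by move=> s _; rewrite insubF ?mul0r //= -ltnS ltnNge leq_addr.
Qed.

End Points.

(** * Decomposition of cyclic codes *)

Section Decomposition.
Variables (L : finFieldType) (L2 : 2%:R = 0 :> L).
Variables (m : nat) (odd_m : odd m) (w : L) (w_prim : m.-primitive_root w).
Variables (a n : nat).
Local Notation N := (2 ^ a)%N.
Hypothesis nE : n = (m * N)%N.
Local Notation point := (@point L m w).
Local Notation Phi P u := (fourier N (point_root P) u).

Let m_gt0 : (0 < m)%N := odd_gt0 odd_m.

Let n_gt0 : (0 < n)%N.
Proof. by rewrite nE muln_gt0 m_gt0 expn_gt0. Qed.

Let cop : coprime m N.
Proof. by rewrite coprimeXr // coprime_sym prime_coprime // dvdn2 odd_m. Qed.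

Lemma fourier_surj h (P : point h) (y : 'rV[P]_N) :
  exists u : 'rV['Z_4]_n, Phi P u = y.
Proof.
(* The factor [point_root P ^+ (m.-1 * j)] undoes the [point_root P ^+ j] that [fourierE] takes out
   of the sum. *)
have /fin_all_exists[c cE] (j : 'I_N) := point_span L2 odd_m w_prim (y 0 j * point_root P ^+ (m.-1 * j)) cop.
have ltm (k : 'I_n) : (k %/ N < m)%N by rewrite ltn_divLR ?expn_gt0 // -nE.
pose q (k : 'I_n) := Ordinal (ltn_pmod k (N_gt0 nE n_gt0)).
exists (\row_k c (q k) (Ordinal (ltm k))); apply/rowP => j.
have lt_jn : (j < n)%N by rewrite (leq_trans (ltn_ord j)) // nE leq_pmull.
rewrite (fourierE nE _ (l := Ordinal lt_jn) (point_root1 P)) /= ?modn_small //.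
transitivity (point_root P ^+ j * (y 0 j * point_root P ^+ (m.-1 * j))).
  rewrite cE; congr (_ * _); apply: eq_bigr => s _; congr (of_Z4 _ * _).
  have jsE : ((j + N * s) %% n = j + N * s)%N.
    rewrite modn_small // nE; apply: (@leq_trans (N * s.+1)).
      by rewrite mulnS ltn_add2r.
    by rewrite mulnC leq_mul2r (ltn_ord s) orbT.
  rewrite mxE; congr (c _ _); apply/val_inj => /=; rewrite jsE.
    by rewrite addnC mulnC modnMDl modn_small.
  by rewrite addnC mulnC divnMDl ?expn_gt0 // divn_small ?addn0.
by rewrite mulrCA -exprD -mulSn prednK // exprM point_root1 expr1n mulr1.
Qed.

Section Isolate.
Variable h : 'I_m.
Local Notation S := (coset2 m h).

Let dblS s : (dbl s \in S) = (s \in S).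
Proof.
have /(coset2_eqP odd_m) E : dbl s \in coset2 m s by rewrite coset2E (fconnect_iter _ 1).
by rewrite coset2_sym // -E coset2_sym.
Qed.

(** The inverse discrete Fourier transform of the indicator function of [S]; the factor [1 / m] is 1
    in characteristic 2. Stability of [S] under doubling puts the values in {0, 1}. *)
Let mask k : L := \sum_(s in S) ((w ^+ s)^-1) ^+ k.

Let mask_sqr k : mask k ^+ 2 = mask k.
Proof.
rewrite sum_sqr // [RHS](reindex_inj (dbl_inj odd_m)) /=.
apply: eq_big => [s|s _]; first by rewrite dblS.
by rewrite /= (expr_mod _ (prim_expr_order w_prim)) exprM [LHS]exprAC -(exprVn _ 2).
Qed.

Let mask01 k : mask k = (mask k != 0)%:R.
Proof.
have [->|nz] //= := eqVneq (mask k) 0.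
by apply: (mulfI nz); rewrite mulr1 -expr2 mask_sqr.
Qed.

Let w_neq0 : w != 0.
Proof.
apply/eqP => w0; have := prim_expr_order w_prim; rewrite w0 expr0n.
by case: (m) m_gt0 => // ? _ /eqP; rewrite eq_sym oner_eq0.
Qed.

Let geom (x : L) : x ^+ m = 1 -> \sum_(k < m) x ^+ k = (x == 1)%:R.
Proof.
move=> x1; have [->|xn1] := eqVneq x 1.
  rewrite (eq_bigr (fun=> 1)) => [|k _]; last by rewrite expr1n.
  by rewrite sumr_const card_ord (natrL L2 m) odd_m.
apply/eqP; have := subrX1 x m; rewrite x1 subrr => /esym/eqP.
by rewrite mulf_eq0 subr_eq0 (negPf xn1).
Qed.

Let mask_eval (l : 'I_m) :
  \sum_(k < m | mask k != 0) (w ^+ (l * N)) ^+ k = (l \in S)%:R.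
Proof.
(* Multiplication by [N = 2 ^ a] amounts to [a] doublings and preserves the coset. *)
have lN : (iter a (@dbl m) l \in S) = (l \in S).
  by elim: a => // i IH; rewrite iterS dblS.
transitivity (\sum_(k < m) \sum_(s in S) (w ^+ (l * N) / w ^+ s) ^+ k).
  rewrite big_mkcond; apply: eq_bigr => k _.
  transitivity (mask k * (w ^+ (l * N)) ^+ k).
    by rewrite [mask k in RHS]mask01; case: ifP => _; rewrite ?mul1r ?mul0r.
  rewrite mulr_suml; apply: eq_bigr => s _.
  by rewrite [RHS]exprMn mulrC.
rewrite exchange_big /=.
have w1 e : (w ^+ e) ^+ m = 1 by rewrite exprAC (prim_expr_order w_prim) expr1n.
rewrite (eq_bigr (fun s => (s == iter a (@dbl m) l)%:R)) => [|s _]; last first.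
  rewrite geom; last by rewrite exprMn exprVn !w1 invr1 mulr1.
  rewrite -[_ == 1](inj_eq (mulIf (expf_neq0 s w_neq0))) mulfVK ?expf_neq0 // mul1r.
  rewrite (eq_prim_root_expr w_prim) -val_eqE /= val_iter_dbl eq_sym.
  by rewrite (modn_small (ltn_ord s)).
rewrite -lN; case: (boolP (_ \in S)) => [lS|lS].
  by rewrite (bigD1 _ lS) /= eqxx big1 ?addr0 // => s /andP[_ /negPf->].
by rewrite big1 // => s sS; case: eqP => // E; rewrite -E sS in lS.
Qed.

Let proj (u : 'rV['Z_4]_n) := \sum_(k < m | mask k != 0) iter (N * k) (@cyclic_shift _ n) u.

Let fourier_proj l (Q : point l) u :
  Phi Q (proj u) = (\sum_(k < m | mask k != 0) point_root Q ^+ (N * k)) *: Phi Q u.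
Proof.
rewrite (fourier_sum (point_char4 Q)) scaler_suml; apply: eq_bigr => k _.
by rewrite (fourier_iterN nE) ?point_root1.
Qed.

(* The coefficients of [proj] only make it idempotent modulo 2; since 4 = 0, its square is idempotent. *)
Lemma fourier_isolate (u : 'rV['Z_4]_n) : exists v : 'rV['Z_4]_n,
  forall l (Q : point l), Phi Q v = if l \in S then Phi Q u else 0.
Proof.
exists (proj (proj u)) => l Q; rewrite !fourier_proj scalerA -expr2.
set x := \sum_(k < m | _) _.
have redx : point_red Q x = (l \in S)%:R.
  rewrite -mask_eval rmorph_sum; apply: eq_bigr => k _ /=.
  by rewrite rmorphXn /= point_red_root -!exprM mulnA.
have [y xy] : exists y, x - (l \in S)%:R = y *+ 2.
  by apply: point_red0; rewrite rmorphB rmorph_nat /= redx subrr.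
rewrite (@sqr_eq_mod2 _ (point_char4 Q) _ (l \in S)%:R y); last by rewrite -xy addrC subrK.
by case: (l \in S); rewrite ?expr1n ?scale1r // expr0n scale0r.
Qed.

Lemma fourier_surj_isolate (P : point h) (y : 'rV[P]_N) : exists u : 'rV['Z_4]_n,
  Phi P u = y /\ forall l (Q : point l), l \notin S -> Phi Q u = 0.
Proof.
have [u0 <-] := fourier_surj y; have [u uE] := fourier_isolate u0.
by exists u; split=> [|l Q /negPf lS]; rewrite uE ?mem_coset2 // lS.
Qed.

End Isolate.

(** By [fourier_dot] the transform of the pairings [g s] of [v] with shifts of [u] vanishes at a
    point of each coset. Joint injectivity kills every [g s], and [g 0] is [dot u v]. *)
Lemma dot_eq0_fourier (u v : 'rV['Z_4]_n) :
  (forall l, exists h (P : point h), l \in coset2 m h /\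
     dot (Phi P u) (Phi (opp_point odd_m w_prim P) v) = 0) ->
  dot u v = 0.
Proof.
move=> dot0; pose g (s : 'I_m) := \sum_(k < n) u 0 (add_ord k (N * s)) * v 0 k.
rewrite -[RHS](fourier_joint_inj (g := g) L2 odd_m w_prim cop _ (Ordinal m_gt0)); last first.
  move=> l; have [h [P [lh S0]]] := dot0 l; exists h, P; split => //.
  by rewrite -(fourier_dot (point_char4 P) nE n_gt0 _ _ (point_root1 P)).
apply: eq_bigr => k _; congr (u 0 _ * _); apply/val_inj.
by rewrite /= muln0 addn0 modn_small.
Qed.

Lemma dot_fourier h (P : point h) (C : {set 'rV['Z_4]_n}) (u v : 'rV['Z_4]_n) :
  cyclic_code C -> u \in C -> v \in euclid_dual C ->
  dot (Phi P u) (Phi (opp_point odd_m w_prim P) v) = 0.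
Proof.
move=> cC uC /euclid_dualP Cv; rewrite (fourier_dot (point_char4 P) nE n_gt0 _ _ (point_root1 P)).
apply: big1 => s _; suff -> : \sum_(k < n) u 0 (add_ord k (N * s)) * v 0 k = 0 by rewrite mul0r.
(* Reading [u] at index [k + N * s] is the same as shifting it by [N * (m - s)], because
   [n = m * N]. *)
pose e := (N * (m - s))%N.
rewrite -[RHS](Cv _ (cyclic_code_iter e cC uC)); apply: eq_bigr => k _; congr (_ * _).
rewrite -(iter_cyclic_shift_add e u); suff -> : add_ord (add_ord k (N * s)) e = k by [].
apply/val_inj; rewrite /= modnDml -addnA -mulnDr.
by rewrite subnKC ?(ltnW (ltn_ord s)) // mulnC -nE modnDr modn_small.
Qed.

End Decomposition.

(** * Codes over a single point: double duals, preimages and images *)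

Section PointCodes.
Variables (L : finFieldType) (L2 : 2%:R = 0 :> L).
Variables (m : nat) (odd_m : odd m) (w : L) (w_prim : m.-primitive_root w).
Variables (a n : nat).
Local Notation N := (2 ^ a)%N.
Hypothesis nE : n = (m * N)%N.
Variables (h : 'I_m) (P : point w h).
Local Notation Phi u := (fourier N (point_root P) u).

Let cop : coprime m N.
Proof. by rewrite coprimeXr // coprime_sym prime_coprime // dvdn2 odd_m. Qed.

(** [x ^+ #|L|.-1] is 1 modulo 2, and squaring makes it exactly 1, so a power of [x] is its
    inverse. *)
Lemma point_unit (x : P) : point_red P x != 0 -> exists y, y * x = 1.
Proof.
move=> x0; have xL : point_red P x ^+ #|L|.-1 = 1.
  apply: (mulfI x0); rewrite mulr1 -exprS prednK ?expf_card //.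
  by apply/card_gt0P; exists 0.
have [y yE] : exists y, x ^+ #|L|.-1 - 1 = y *+ 2.
  by apply: point_red0; rewrite rmorphB rmorph1 rmorphXn /= xL subrr.
have sq1 : (x ^+ #|L|.-1) ^+ 2 = 1.
  by rewrite (@sqr_eq_mod2 _ (point_char4 P) _ 1 y) ?expr1n // -yE addrC subrK.
have Lgt1 : (1 < #|L|)%N by apply: finRing_gt1.
exists (x ^+ (#|L|.-1 * 2).-1); rewrite -exprSr prednK ?exprM //.
by rewrite muln_gt0 -subn1 subn_gt0 Lgt1.
Qed.

(** A nonzero element is a unit or twice a unit, because twice a nonunit is a multiple of 4. *)
Lemma point_div2 (x : P) : x != 0 -> exists y, y * x = 2%:R.
Proof.
move=> x0; have [/point_red0[z zE]|/point_unit[y yE]] := eqVneq (point_red P x) 0; last first.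
  by exists (2%:R * y); rewrite -mulrA yE mulr1.
have [/point_red0[z' zE']|/point_unit[y yE]] := eqVneq (point_red P z) 0.
  by rewrite zE zE' -mulrnA -mulr_natr (point_char4 P) mulr0 eqxx in x0.
by exists y; rewrite zE mulrnAr yE.
Qed.

Lemma point_euclid_dualK p (C : {set 'rV[P]_p}) : submodule C ->
  euclid_dual (euclid_dual C) = C.
Proof.
have [f [fD f2]] := point_functional P.
by move=> sC; apply: (euclid_dualK fD f2 _ sC) => x; apply: point_div2.
Qed.

Lemma fourier_preim_code (D : {set 'rV[P]_N}) : cyclic_code D ->
  cyclic_code [set u : 'rV['Z_4]_n | Phi u \in D].
Proof.
case/andP=> sD /forall_inP shD; apply/andP; split.
  apply/submoduleP; split=> [|c u v]; rewrite !inE.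
    by rewrite fourier0; case/submoduleP: sD.
  by move=> uD vD; rewrite (fourierD (point_char4 P)) (fourierZ (point_char4 P)) submoduleD ?submoduleZ.
apply/forall_inP => u; rewrite !inE => uD.
by rewrite (fourier_shift nE) ?point_root1 // submoduleZ ?shD.
Qed.

(** Closure under scalars of [P] comes from [point_span]: a scalar is a combination over ['Z_4] of
    the powers [point_root P ^+ (N * s)], and these act as shifts by [N * s]. *)
Lemma fourier_image_code (C : {set 'rV['Z_4]_n}) : cyclic_code C ->
  cyclic_code [set Phi u | u in C].
Proof.
move=> cC; have [sC /forall_inP shC] := andP cC.
have sI : submodule [set Phi u | u in C].
  apply/submoduleP; split=> [|b _ _ /imsetP[u uC ->] /imsetP[v vC ->]].
    by apply/imsetP; exists 0; rewrite ?fourier0 //; case/submoduleP: sC.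
  have [c ->] := point_span L2 odd_m w_prim b cop.
  apply/imsetP; exists (\sum_(s < m) c s *: iter (N * s) (@cyclic_shift _ n) u + v).
    apply: submoduleD => //; apply: submodule_sum => // s _; apply: submoduleZ => //.
    exact: cyclic_code_iter.
  rewrite (fourierD (point_char4 P)) (fourier_sum (point_char4 P)) scaler_suml; congr (_ + _).
  apply: eq_bigr => s _; rewrite (fourierZ (point_char4 P)) (fourier_iterN nE) ?point_root1 //.
  by rewrite scalerA.
apply/andP; split=> //; apply/forall_inP => _ /imsetP[u uC ->].
have -> : cyclic_shift (Phi u) = point_root P ^+ m.-1 *: Phi (cyclic_shift u).
  rewrite (fourier_shift nE) ?point_root1 // scalerA -exprSr prednK ?(odd_gt0 odd_m) //.
  by rewrite point_root1 scale1r.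
by apply: submoduleZ => //; apply: imset_f; apply: shC.
Qed.

End PointCodes.

(** With the identity as [bar] this is the Euclidean dual, with [gr4_bar] the Hermitian one, so the
    coset {0} and those of [J1] are treated alike. *)
Definition twisted_dual (R : finComNzRingType) (bar : R -> R) (p : nat)
    (C : {set 'rV[R]_p}) : {set 'rV[R]_p} :=
  [set v : 'rV[R]_p | [forall u in C, \sum_i u 0 i * bar (v 0 i) == 0]].

Lemma twisted_dualE (R : finComNzRingType) (bar : R -> R) p (C : {set 'rV[R]_p}) v :
  (v \in twisted_dual bar C) = (map_mx bar v \in euclid_dual C).
Proof.
by rewrite !inE; apply/eq_forallb => u; congr (_ ==> (_ == _)); apply: eq_bigr => i _; rewrite mxE.
Qed.

Lemma dot0r (R : finComNzRingType) p (u : 'rV[R]_p) : dot u 0 = 0.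
Proof. by apply: big1 => i _; rewrite mxE mulr0. Qed.

Lemma cyclic_codeI (R : finComNzRingType) p (C D : {set 'rV[R]_p}) :
  cyclic_code C -> cyclic_code D -> cyclic_code (C :&: D).
Proof.
case/andP=> /submoduleP[C0 Cl] /forall_inP Cs /andP[/submoduleP[D0 Dl] /forall_inP Ds].
apply/andP; split; last first.
  by apply/forall_inP => u /setIP[uC uD]; rewrite inE Cs ?Ds.
apply/submoduleP; split=> [|c u v /setIP[uC uD] /setIP[vC vD]]; first by apply/setIP.
by apply/setIP; split; [apply: Cl | apply: Dl].
Qed.

Lemma cyclic_code_bigcap (R : finComNzRingType) p (T : finType) (A : pred T)
    (C : T -> {set 'rV[R]_p}) :
  (forall i, A i -> cyclic_code (C i)) -> cyclic_code (\bigcap_(i | A i) C i).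
Proof.
move=> cC; elim/big_ind: _ => //; last exact: cyclic_codeI.
apply/andP; split; last by apply/forall_inP => u _; rewrite inE.
by apply/submoduleP; split=> [|c u v _ _]; rewrite inE.
Qed.

(** * Reconstruction of a self-dual code from its images *)

Section Global.
Variables (L : finFieldType) (L2 : 2%:R = 0 :> L).
Variables (m : nat) (odd_m : odd m) (w : L) (w_prim : m.-primitive_root w).
Variables (a n : nat).
Local Notation N := (2 ^ a)%N.
Hypothesis nE : n = (m * N)%N.
Variables (I : {set 'I_m}) (P : forall i : 'I_m, point w i) (bar : forall i, {rmorphism P i -> P i}).
Arguments P i : clear implicits.
Local Notation opp i := (opp_point odd_m w_prim (P i)).
Local Notation Phi i u := (fourier N (point_root (P i)) u).
Local Notation Phi' i u := (fourier N (point_root (opp i)) u).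

(** Together with [sep], this makes [I] a set of representatives of the cosets up to sign. *)
Hypothesis cover : forall l, exists2 i, i \in I & (l \in coset2 m i) || (l \in coset2 m (opp_mod i)).
Hypothesis sep : forall i j, i \in I -> j \in I -> i != j ->
  (j \notin coset2 m i) && (opp_mod j \notin coset2 m i).
Hypothesis bar_root : forall i, i \in I -> opp_mod i \in coset2 m i ->
  bar i (point_root (P i)) = point_root (P i) ^+ m.-1.

Let cop : coprime m N.
Proof. by rewrite coprimeXr // coprime_sym prime_coprime // dvdn2 odd_m. Qed.

(** The square of [m - 1] is 1 modulo [m]. Only the roots are compared, since the two points have
    different types. *)
Let root_opp2 i : point_root (opp_point odd_m w_prim (opp i)) = point_root (P i).
Proof.
have r1 := point_root1 (P i).
rewrite /= -exprM -[LHS](expr_mod _ r1) -[RHS]expr1 -[RHS](expr_mod _ r1); congr (_ ^+ _).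
apply/eqP; rewrite -(eqn_modDr m.-1) -mulSnr addSn prednK ?(odd_gt0 odd_m) //.
by rewrite modnn modnMr.
Qed.

Let Phi_bar i (u : 'rV['Z_4]_n) : i \in I -> opp_mod i \in coset2 m i ->
  Phi' i u = map_mx (bar i) (Phi i u).
Proof.
move=> iI si; apply/rowP => j; rewrite !mxE rmorph_sum; apply: eq_bigr => k _ /=.
by rewrite rmorphM rmorph_nat rmorphXn /= bar_root.
Qed.

(** For the converse, pair [v] with [C]. On the coset of [i] the second condition applies; on that
    of [-i] the transform of [v] involved is that of some [c] in [C], which is orthogonal to [C]. *)
Let self_dual_mem (C : {set 'rV['Z_4]_n}) v : cyclic_code C -> C = euclid_dual C ->
  (v \in C) = [forall i in I, (Phi i v \in [set Phi i u | u in C]) &&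
                              (Phi' i v \in euclid_dual [set Phi i u | u in C])].
Proof.
move=> cC CE; apply/idP/forall_inP => [vC i iI|vP].
  rewrite imset_f //=; apply/euclid_dualP => _ /imsetP[u uC ->].
  by apply: (dot_fourier odd_m w_prim nE _ cC uC); rewrite -CE.
rewrite CE; apply/euclid_dualP => u uC; apply: (dot_eq0_fourier L2 (odd_m:=odd_m) (w_prim:=w_prim) nE) => l.
have [i iI] := cover l; have /andP[/imsetP[c cC' vc] /euclid_dualP vd] := vP i iI.
case/orP => li; first by exists i, (P i); split => //; apply: vd; apply: imset_f.
exists (opp_mod i), (opp i); split=> //.
have -> : fourier N (point_root (opp_point odd_m w_prim (opp i))) v =
    fourier N (point_root (opp_point odd_m w_prim (opp i))) c by rewrite root_opp2.
by apply: (dot_fourier odd_m w_prim nE _ cC uC); rewrite -CE.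
Qed.

(** No duality condition is imposed off the self-inverse cosets: there [D] is free and the component
    at [-i] is its dual. *)
Let good i (D : {set 'rV[P i]_N}) :=
  cyclic_code D && ((opp_mod i \in coset2 m i) ==> (D == twisted_dual (bar i) D)).

(** For the harder inclusion, lift a word [y] of the twisted dual to [u] with zero transforms off
    the coset of [i]. Only that coset could obstruct orthogonality to [C], so [u] lies in the
    self-dual [C]. *)
Let image_good (C : {set 'rV['Z_4]_n}) i : i \in I -> cyclic_code C -> C = euclid_dual C ->
  good [set Phi i u | u in C].
Proof.
move=> iI cC CE; rewrite /good fourier_image_code //=; apply/implyP => si.
apply/eqP/setP => y; rewrite twisted_dualE; apply/idP/idP => [/imsetP[u uC ->]|yD].
  rewrite -Phi_bar //.
  by move: uC; rewrite (self_dual_mem _ cC CE) => /forall_inP/(_ i iI)/andP[].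
have [u [uy u0]] := fourier_surj_isolate L2 odd_m w_prim nE (P:=P i) y.
apply/imsetP; exists u; rewrite ?uy //.
rewrite CE; apply/euclid_dualP => c cC'; apply: (dot_eq0_fourier L2 (odd_m:=odd_m) (w_prim:=w_prim) nE) => l.
have [li|li] := boolP (l \in coset2 m i).
  exists i, (P i); split=> //.
  rewrite [X in dot _ X](Phi_bar _ iI si) uy.
  by move/euclid_dualP: yD => -> //; apply: imset_f.
have oppS k : (opp_mod k \in coset2 m i) = (k \in coset2 m i).
  by move/(coset2_eqP odd_m): (si) => {1}->; rewrite coset2_opp.
have [j jI /orP[lj|lj]] := cover l.
  exists j, (P j); split=> //; rewrite (u0 _ (opp j)) ?dot0r // oppS.
  by apply: contra li => /(coset2_eqP odd_m) ->.
exists (opp_mod j), (opp j); split=> //.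
have -> : fourier N (point_root (opp_point odd_m w_prim (opp j))) u = Phi j u by rewrite root_opp2.
rewrite (u0 _ (P j)) ?dot0r //.
by apply: contra li; rewrite -oppS => /(coset2_eqP odd_m) ->.
Qed.

(* The self-dual code with prescribed images under the transforms at the points of [I]. *)
Let build (D : forall i, {set 'rV[P i]_N}) : {set 'rV['Z_4]_n} :=
  \bigcap_(i in I) ([set u | Phi i u \in D i] :&: [set u | Phi' i u \in euclid_dual (D i)]).

Section Build.
Variable D : forall i, {set 'rV[P i]_N}.
Hypothesis goodD : forall i, i \in I -> good (D i).

Let D_code i : i \in I -> cyclic_code (D i).
Proof. by move/goodD/andP => []. Qed.

Let D_twisted i : i \in I -> opp_mod i \in coset2 m i -> D i = twisted_dual (bar i) (D i).
Proof. by move=> /goodD/andP[_ /implyP di] /di/eqP. Qed.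

Let D0 i : i \in I -> 0 \in D i.
Proof. by move/D_code/andP => [/submoduleP[]]. Qed.

Let dual0 i : 0 \in euclid_dual (D i).
Proof. by case/submoduleP: (euclid_dual_submodule (D i)). Qed.

Let buildP (v : 'rV['Z_4]_n) : reflect (forall i, i \in I -> Phi i v \in D i /\ Phi' i v \in euclid_dual (D i))
  (v \in build D).
Proof.
apply: (iffP bigcapP) => H i iI; have := H i iI; first by case/setIP; rewrite !in_set.
by case=> v1 v2; apply/setIP; split; rewrite in_set.
Qed.

Lemma build_code : cyclic_code (build D).
Proof.
apply: cyclic_code_bigcap => i iI; apply: cyclic_codeI.
  by apply: fourier_preim_code => //; apply: D_code.
apply: (fourier_preim_code nE (P := opp i)).
by apply: euclid_dual_cyclic; apply: D_code.
Qed.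

(** A lift of [y] that vanishes off the coset of [i] meets the conditions at every other [j] by
    [sep]. Its transform at [-i] is either zero or the conjugate of [y], which twisted self-duality
    covers. *)
Lemma build_image i : i \in I -> [set Phi i u | u in build D] = D i.
Proof.
move=> iI; apply/setP=> y; apply/imsetP/idP => [[u /buildP/(_ i iI)[uD _] ->] //|yD].
have [u [uy u0]] := fourier_surj_isolate L2 odd_m w_prim nE (P:=P i) y.
exists u => //; apply/buildP => j jI; have [ij|ij] := eqVneq i j; last first.
  have /andP[s1 s2] := sep iI jI ij.
  by rewrite (u0 _ (P j)) // (u0 _ (opp j)) // D0 ?dual0.
case: j / ij jI => _; rewrite uy; split=> //.
have [si|si] := boolP (opp_mod i \in coset2 m i); last by rewrite (u0 _ (opp i)) ?dual0.
by rewrite [X in X \in _](Phi_bar _ iI si) uy -twisted_dualE -D_twisted.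
Qed.

Lemma build_image_opp i (y : 'rV[P i]_N) : i \in I -> opp_mod i \notin coset2 m i ->
  y \in euclid_dual (D i) -> exists2 u, u \in build D & y = Phi' i u.
Proof.
move=> iI si yD; have [u [uy u0]] := fourier_surj_isolate L2 odd_m w_prim nE (P:=opp i) y.
exists u => //; apply/buildP => j jI; have [ij|ij] := eqVneq i j; last first.
  have /andP[s1 s2] := sep iI jI ij.
  have j1 : Phi j u = 0 by apply: (u0 _ (P j)); rewrite -coset2_opp // opp_modK.
  have j2 : Phi' j u = 0 by apply: (u0 _ (opp j)); rewrite coset2_opp.
  by rewrite j1 j2 D0 ?dual0.
case: j / ij jI => _; rewrite uy; split=> //; rewrite (u0 _ (P i)) ?D0 //.
by rewrite coset2_sym.
Qed.

(** A word orthogonal to the code has its transform at [-i] in the dual of [D i] by [build_image].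
    Its transform at [i] is then in [D i] by twisted self-duality or, off the self-inverse cosets,
    by the double dual and [build_image_opp]. *)
Lemma build_self_dual : build D = euclid_dual (build D).
Proof.
apply/setP => v; apply/idP/idP => [/buildP vB|vB].
  apply/euclid_dualP => u /buildP uB; apply: (dot_eq0_fourier L2 (odd_m:=odd_m) (w_prim:=w_prim) nE) => l.
  have [i iI /orP[li|li]] := cover l; have [uD uD'] := uB i iI; have [vD vD'] := vB i iI.
    by exists i, (P i); split=> //; move/euclid_dualP: vD'; apply.
  exists (opp_mod i), (opp i); split=> //.
  have -> : fourier N (point_root (opp_point odd_m w_prim (opp i))) v = Phi i v by rewrite root_opp2.
  by rewrite dotC; move/euclid_dualP: uD'; apply.
have bC := build_code; apply/buildP => i iI.
have vD' : Phi' i v \in euclid_dual (D i).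
  apply/euclid_dualP => x; rewrite -(build_image iI) => /imsetP[u uB ->].
  exact: (dot_fourier odd_m w_prim nE (P i) bC uB vB).
split=> //; have [si|si] := boolP (opp_mod i \in coset2 m i).
  by rewrite D_twisted // twisted_dualE -Phi_bar.
have sD : submodule (D i) by case/andP: (D_code iI).
rewrite -(point_euclid_dualK sD); apply/euclid_dualP => y /(build_image_opp iI si)[u uB ->].
have <- : fourier N (point_root (opp_point odd_m w_prim (opp i))) v = Phi i v by rewrite root_opp2.
exact: (dot_fourier odd_m w_prim nE (opp i) bC uB vB).
Qed.

End Build.

Lemma card_euclid_self_dual : num_euclid_self_dual 'Z_4 n =
  (\prod_(i in I) #|[set D : {set 'rV[P i]_N} | cyclic_code D &
      (opp_mod i \in coset2 m i) ==> (D == twisted_dual (bar i) D)]|)%N.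
Proof.
pose T i : finType := {set 'rV[P i]_N}.
(* Outside [I] the component is fixed as [set0], which contributes a factor 1. *)
pose F i : {set T i} := if i \in I then [set D | good D] else [set set0].
pose theta (C : {set 'rV['Z_4]_n}) : {dffun forall i, T i} :=
  [ffun i => (if i \in I then [set Phi i u | u in C] else set0) : T i].
pose S := [set C : {set 'rV['Z_4]_n} | cyclic_code C & C == euclid_dual C].
have theta_inj : {in S &, injective theta}.
  move=> C C'; rewrite !inE => /andP[cC /eqP CE] /andP[cC' /eqP CE'] CC'.
  apply/setP => v; rewrite (self_dual_mem v cC CE) (self_dual_mem v cC' CE').
  apply/eq_forallb_in => i iI; move/ffunP/(_ i): CC'; rewrite !ffunE iI => ->.
  by [].
rewrite /num_euclid_self_dual -/S -(card_in_imset theta_inj).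
transitivity #|setXn F|.
  apply: eq_card => D; apply/imsetP/setXnP => [[C + ->] i|FD].
    rewrite inE => /andP[cC /eqP CE]; rewrite ffunE /F; case: ifP => iI; last by rewrite inE.
    by rewrite inE image_good.
  have goodD i : i \in I -> good (D i) by move=> iI; have := FD i; rewrite /F iI inE.
  exists (build D); first by rewrite inE build_code // -build_self_dual ?eqxx.
  apply/ffunP => i; rewrite ffunE; case: ifP => iI; first by rewrite build_image.
  by have := FD i; rewrite /F iI inE => /eqP.
rewrite cardsXn [RHS]big_mkcond; apply: eq_bigr => i _; rewrite /F; case: ifP => _ //.
by rewrite cards1.
Qed.

End Global.

(** * Galois rings and their Frobenius automorphisms *)

Lemma card_expf_fixed (F : finFieldType) q : (1 < q)%N -> (#|[set z : F | z ^+ q == z]| <= q)%N.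
Proof.
move=> q_gt1; have szX : size ('X^q - 'X : {poly F}) = q.+1.
  by rewrite size_polyDl size_polyXn // size_polyN size_polyX.
rewrite -ltnS -szX cardE; apply: max_poly_roots; rewrite ?enum_uniq //.
  by rewrite -size_poly_eq0 szX.
apply/allP => z; rewrite mem_enum inE => /eqP zq.
by rewrite /root !hornerE zq subrr.
Qed.

Lemma finField_prim_root_exists (F : finFieldType) : exists z : F, #|F|.-1.-primitive_root z.
Proof.
have F_gt1 := finRing_gt1 F.
have /hasP[z _ zP] : has #|F|.-1.-primitive_root (enum (predC1 (0 : F))).
  apply: has_prim_root; rewrite ?enum_uniq //; first by rewrite -subn1 subn_gt0.
    apply/allP => x; rewrite mem_enum inE => x0; rewrite unity_rootE.
    by apply/eqP/(mulfI x0); rewrite mulr1 -exprS prednK ?expf_card // ltnW.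
  by rewrite -cardE cardC1.
by exists z.
Qed.

(** * Irreducible polynomials over F_2 and their roots in a finite field *)

Section Embeddings.
Variables (L : finFieldType) (L2 : 2%:R = 0 :> L).

(* The discarded proof argument lets the ring morphism instances be inferred. *)
Definition emb2 of (2%:R = 0 :> L) := fun x : 'F_2 => (nat_of_ord x)%:R : L.
Local Notation emb := (emb2 L2).

Let modL2 k : (k %% 2)%:R = k%:R :> L.
Proof. by rewrite [in RHS](divn_eq k 2) natrD natrM L2 mulr0 add0r. Qed.

Let emb2_zmod : zmod_morphism emb.
Proof.
have embD x y : emb (x + y) = emb x + emb y by rewrite /emb2 /= modL2 natrD.
by move=> x y; apply: (addIr (emb y)); rewrite -embD !subrK.
Qed.

Let emb2_monoid : monoid_morphism emb.
Proof. by split=> // x y; rewrite /emb2 /= modL2 natrM. Qed.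

HB.instance Definition _ := GRing.isZmodMorphism.Build 'F_2 L emb emb2_zmod.
HB.instance Definition _ := GRing.isMonoidMorphism.Build 'F_2 L emb emb2_monoid.

Lemma emb2_sqr x : emb x ^+ 2 = emb x.
Proof. by case: x => [[|[|k]]] // klt; rewrite /emb2 /= ?expr0n ?expr1n. Qed.

Lemma emb2_horner_sqr (p : {poly 'F_2}) x :
  (map_poly emb p).[x ^+ 2] = (map_poly emb p).[x] ^+ 2.
Proof.
rewrite !horner_coef (sum_sqr L2); apply: eq_bigr => i _.
by rewrite coef_map [RHS]exprMn emb2_sqr exprAC.
Qed.

Lemma emb2_horner_exp2 (p : {poly 'F_2}) x r :
  (map_poly emb p).[x ^+ (2 ^ r)] = (map_poly emb p).[x] ^+ (2 ^ r).
Proof.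
elim: r => [|r IH]; first by rewrite !expr1.
by rewrite expnSr !exprM emb2_horner_sqr IH.
Qed.

Variables (g : {poly 'F_2}) (r M : nat).
Hypotheses (g_monic : g \is monic) (g_irr : irreducible_poly g) (size_g : size g = r.+1).
Hypotheses (r_gt0 : (0 < r)%N) (rM : (r %| M)%N) (cardL : #|L| = (2 ^ M)%N).

(** The quotient by [g] is a field with [2 ^ r] elements, so its [2 ^ d]-th power map is the
    identity; apply this to the class of ['X]. *)
Let g_dvd d : (r %| d)%N -> g %| 'X^(2 ^ d) - 'X.
Proof.
move=> rd; have gI : monic_irreducible_poly g by split.
have K1 (x : {poly %/ g with gI}) : x ^+ (2 ^ d) = x.
  have cardK : #|{poly %/ g with gI}| = (2 ^ r)%N by rewrite card_qfpoly card_Fp // size_g.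
  case/dvdnP: rd => k ->; elim: k => [|k IH]; first by rewrite mul0n expr1.
  by rewrite mulSn expnD exprM -[X in (x ^+ X) ^+ _]cardK expf_card.
have := K1 (in_qpoly g 'X); rewrite -rmorphXn => /(congr1 val) /= /eqP.
rewrite -subr_eq0 -Pdiv.RingMonic.rmodpB ?monic_mk_monic // mk_monicE // => h.
by rewrite Pdiv.Idomain.dvdpE.
Qed.

(** [g] divides ['X^(2 ^ M) - 'X], which is the product of ['X - x] over all [x] in [L]. *)
Lemma irreducible_root_exists : exists x : L, root (map_poly emb g) x.
Proof.
have gX := g_dvd rM.
have /dvdp_prod_XsubC[s gs] : map_poly emb g %| \prod_(x <- enum L) ('X - x%:P).
  rewrite big_enum /= -finField_genPoly cardL.
  have -> : 'X^(2 ^ M) - 'X = map_poly emb ('X^(2 ^ M) - 'X) by rewrite rmorphB /= map_polyXn map_polyX.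
  by rewrite dvdp_map.
have : size (map_poly emb g) = r.+1 by rewrite size_map_poly.
rewrite (eqp_size gs) => sz; case E : (mask s (enum L)) sz gs => [|x t] sz gs.
  by move: sz; rewrite big_nil size_poly1 => -[r0]; have := r_gt0; rewrite -r0.
by exists x; rewrite (eqp_root gs) big_cons rootM root_XsubC eqxx.
Qed.

Variables (x : L) (gx : root (map_poly emb g) x).

Lemma irreducible_root_period : x ^+ (2 ^ r) = x.
Proof.
have /dvdpP[q qE] := g_dvd (dvdnn r).
have := congr1 (fun p => (map_poly emb p).[x]) qE.
rewrite rmorphB rmorphM /= map_polyXn map_polyX hornerM (eqP gx) mulr0.
by rewrite !hornerE => /eqP; rewrite subr_eq0 => /eqP.
Qed.

Lemma irreducible_root_ann (p : {poly 'F_2}) : (size p <= r)%N ->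
  (map_poly emb p).[x] = 0 -> p = 0.
Proof.
move=> sp px; have [gp|ngp] := boolP (g %| p).
  apply/eqP; apply: contraTT gp => p0; rewrite gtNdvdp // size_g ltnS //.
have : coprimep g p by rewrite irreducible_poly_coprime.
rewrite -(coprimep_map emb) => /coprimep_root/(_ gx).
by rewrite px eqxx.
Qed.

(** The [2 ^ r] polynomials of size at most [r] take distinct values at [x], all among the at most
    [2 ^ r] solutions of [z ^+ (2 ^ r) = z]. *)
Lemma irreducible_root_image (y : L) : y ^+ (2 ^ r) = y ->
  exists2 p : {poly 'F_2}, (size p <= r)%N & (map_poly emb p).[x] = y.
Proof.
move=> yr; pose ev (p : {poly_r 'F_2}) : L := (map_poly emb p).[x].
have ev_inj : injective ev.
  move=> p q /eqP; rewrite -subr_eq0 -hornerN -hornerD -rmorphN -rmorphD /= => /eqP.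
  move/irreducible_root_ann => pq; apply/val_inj/eqP; rewrite -subr_eq0; apply/eqP/pq.
  by rewrite (leq_trans (size_polyD _ _)) // geq_max size_polyN !size_npoly.
pose Z := [set z : L | z ^+ (2 ^ r) == z].
have evZ : [set ev p | p in {poly_r 'F_2}] \subset Z.
  apply/subsetP => _ /imsetP[p _ ->]; rewrite inE /ev -emb2_horner_exp2.
  by rewrite irreducible_root_period.
have cardZ : (#|Z| <= 2 ^ r)%N by apply: card_expf_fixed; rewrite -{1}(expn0 2) ltn_exp2l.
have /eqP evE : [set ev p | p in {poly_r 'F_2}] == Z.
  rewrite eqEcard evZ (leq_trans cardZ) // card_imset // card_npoly card_Fp //.
have : y \in Z by rewrite inE yr.
by rewrite -evE => /imsetP[p _ ->]; exists p => //; apply: size_npoly.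
Qed.

End Embeddings.

Lemma red2_zmod : zmod_morphism red2.
Proof.
have red2D x y : red2 (x + y) = red2 x + red2 y.
  by apply/val_inj; rewrite /= modn_dvdm // modnDm.
by move=> x y; apply: (addIr (red2 y)); rewrite -red2D !subrK.
Qed.

Lemma red2_monoid : monoid_morphism red2.
Proof.
split=> [|x y]; first exact/val_inj.
by apply/val_inj; rewrite /= modn_dvdm // modnMm.
Qed.

HB.instance Definition _ := GRing.isZmodMorphism.Build 'Z_4 'F_2 red2 red2_zmod.
HB.instance Definition _ := GRing.isMonoidMorphism.Build 'Z_4 'F_2 red2 red2_monoid.

Lemma red2_eq0 x : (red2 x == 0) = ~~ odd x.
Proof. by rewrite -val_eqE /= modn2 eqb0. Qed.

Lemma Z4_half (c : 'Z_4) : ~~ odd c -> (inZp c./2 : 'Z_4) *+ 2 = c.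
Proof. by case: c => [[|[|[|[|k]]]] klt] // _; apply/val_inj. Qed.

Lemma Z4_double_eq0 (c : 'Z_4) : c *+ 2 = 0 -> ~~ odd c.
Proof. by case: c => [[|[|[|[|k]]]] klt]. Qed.

(** If [-h = h * 2 ^ i] with [i < r], then [2 * i] doublings fix [h], so [r] divides [2 * i]; as [h]
    is not [-h] for odd [m], [i] is positive and [2 * i = r]. This matches the exponent in
    [gr4_bar]. *)
Lemma opp_mod_half m (h : 'I_m) : odd m -> (0 < h)%N -> opp_mod h \in coset2 m h ->
  opp_mod h = iter (#|coset2 m h|./2) (@dbl m) h.
Proof.
move=> odd_m h_gt0; rewrite coset2E card_coset2 // => hh.
set r := fingraph.order _ _; set i := findex (@dbl m) h (opp_mod h).
have ir : (i < r)%N by apply: findex_max.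
have iE : iter i (@dbl m) h = opp_mod h by apply: iter_findex.
have iiE : iter (i + i) (@dbl m) h = h.
  by rewrite iterD iE -opp_mod_iter // iE opp_modK.
have f0 : findex (@dbl m) h h = 0%N by rewrite findex0.
have i_gt0 : (0 < i)%N.
  rewrite lt0n; apply/eqP => i0; move: iE; rewrite i0 /= => /(congr1 val) /=.
  have := ltn_ord h; rewrite modn_small; last by lia.
  by move=> h_lt hE; move: odd_m; lia.
have ri : (r <= i + i)%N.
  rewrite leqNgt; apply/negP => lt; have := findex_iter lt.
  by rewrite iiE f0; lia.
have lt : (i + i - r < r)%N by lia.
have := findex_iter lt.
have -> : iter (i + i - r) (@dbl m) h = h.
  by rewrite -{1}(iter_order (dbl_inj odd_m) h) -iterD subnK.
rewrite f0 => E; have -> : r = (i + i)%N by lia.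
by rewrite addnn doubleK iE.
Qed.

(** * Reduction of the Galois ring modulo 2 *)

Section GaloisRing.
Variables (L : finFieldType) (L2 : 2%:R = 0 :> L).
Variables (r M : nat) (r_gt0 : (0 < r)%N) (rM : (r %| M)%N) (cardL : #|L| = (2 ^ M)%N).
Local Notation f := (gr4_poly r).
Local Notation R := (GR4 r).
Local Notation g := (map_poly red2 f).
Local Notation emb := (emb2 L2).

Let f_monic : f \is monic. Proof. by case/and3P: (gr4_polyP r_gt0). Qed.
Let size_f : size f = r.+1. Proof. by apply/eqP; case/and3P: (gr4_polyP r_gt0). Qed.
Let g_irr : irreducible_poly g.
Proof. by apply/irreducibleP; case/and3P: (gr4_polyP r_gt0). Qed.
Let g_monic : g \is monic. Proof. exact: monic_map. Qed.
Let size_g : size g = r.+1.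
Proof. by rewrite size_map_poly_id0 ?size_f // (monicP f_monic) rmorph1 oner_eq0. Qed.
(** [mk_monic] falls back to a default polynomial unless its argument is monic of positive
    degree. *)
Let mkE : mk_monic f = f.
Proof. by rewrite /mk_monic f_monic size_f ltnS r_gt0. Qed.

Lemma card_gr4 : #|{: R}| = (4 ^ r)%N.
Proof. by rewrite card_monic_qpoly ?f_monic ?size_f // card_ord. Qed.

Lemma gr4_char4 : 4%:R = 0 :> R.
Proof.
apply: val_inj; apply: etrans (qpolyC_natr f 4) _.
by rewrite -polyC_natr (_ : 4%:R = 0 :> 'Z_4) ?polyC0 //; apply/val_inj.
Qed.

Lemma gr4_even (x : R) : (forall i, ~~ odd ((val x)`_i)%R) -> exists y : R, x = y *+ 2.
Proof.
move=> x_even; pose y : R := mk_npoly _ (fun i => inZp ((val x)`_i)%R./2 : 'Z_4).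
exists y; apply/val_inj; rewrite [val (_ *+ 2)]raddfMn /=; apply/polyP => i.
rewrite coefMn coef_poly; case: ltnP => [_|ge]; last first.
  by rewrite mul0rn nth_default // (leq_trans _ ge) // size_npoly.
by rewrite Z4_half ?x_even.
Qed.

Lemma gr4_tors (x : R) : x *+ 2 = 0 -> exists y : R, x = y *+ 2.
Proof.
move=> x2; apply: gr4_even => i; have := congr1 (fun p : R => (val p)`_i) x2.
rewrite [val (_ *+ 2)]raddfMn /= coefMn coef0.
exact: Z4_double_eq0.
Qed.

Lemma gr4_functional : exists c : R -> 'Z_4, {morph c : x y / x + y} /\ c 2%:R = 2%:R.
Proof.
exists (fun x : R => (polyn x)`_0); split=> [x y|]; first by rewrite /= coefD.
have -> : polyn (2%:R : R) = 2%:R%:P by rewrite polyC_natr; apply: (qpolyC_natr f 2).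
by rewrite coefC.
Qed.

(** Reduce coefficients modulo 2 and evaluate at a root [b] of [g] in [L]: this embeds the residue
    field as the subfield with [2 ^ r] elements. *)
Lemma gr4_red_exists : exists red : {rmorphism R -> L},
  [/\ forall x, red x = 0 -> exists y, x = y *+ 2,
      forall x, red x ^+ (2 ^ r) = red x &
      forall z, z ^+ (2 ^ r) = z -> exists x, red x = z].
Proof.
have [b gb] := irreducible_root_exists L2 g_monic g_irr size_g r_gt0 rM cardL.
pose red (p : R) : L := (map_poly emb (map_poly red2 (val p))).[b].
have redD : zmod_morphism red.
  by move=> x y; rewrite /red /= !rmorphB /= hornerD hornerN.
have redM : monoid_morphism red.
  split=> [|x y]; first by rewrite /red /= !rmorph1 hornerC.
  have gb' : (map_poly emb (map_poly red2 (mk_monic f))).[b] = 0 by rewrite mkE; apply/eqP.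
  rewrite /red [val (x * y)]poly_of_qpolyM.
  have := congr1 (fun p => (map_poly emb (map_poly red2 p)).[b])
    (Pdiv.RingMonic.rdivp_eq (monic_mk_monic f) (val x * val y)).
  rewrite rmorphM rmorphD !rmorphM rmorphD rmorphM /= hornerM hornerD hornerM gb' mulr0 add0r.
  by move=> ->.
pose redm : {rmorphism R -> L} := HB.pack red
  (GRing.isZmodMorphism.Build R L red redD) (GRing.isMonoidMorphism.Build R L red redM).
have szx (x : R) : (size (val x) <= r)%N.
  by apply: leq_trans (size_npoly x) _; rewrite mkE size_f.
exists redm; split=> [x|x|z zr].
- move/(irreducible_root_ann g_irr size_g gb) => x0; apply: gr4_even => i.
  rewrite -red2_eq0 -coef_map x0 ?coef0 //.
  by rewrite (leq_trans (size_poly _ _)).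
- rewrite /= /red -emb2_horner_exp2.
  by rewrite (irreducible_root_period g_monic g_irr size_g gb).
- have [p sp <-] := irreducible_root_image g_monic g_irr size_g r_gt0 gb zr.
  pose x : R := mk_npoly _ (fun i => inZp ((p`_i)%R) : 'Z_4).
  exists x; rewrite /= /red; congr (_.[_]); congr (map_poly _ _); apply/polyP => i.
  rewrite coef_map coef_poly mkE size_f /=; case: ltnP => [_|ge]; last first.
    by rewrite rmorph0 nth_default // (leq_trans sp).
  apply/val_inj; rewrite /= modn_dvdm // modn_small //.
Qed.

End GaloisRing.

(** * Teichmueller representatives and conjugation *)

Section Bar.
Variables (L : finFieldType) (L2 : 2%:R = 0 :> L).
Variables (r M : nat) (r_gt0 : (0 < r)%N) (rM : (r %| M)%N) (cardL : #|L| = (2 ^ M)%N).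
Local Notation R := (GR4 r).
Variable red : {rmorphism R -> L}.
Hypothesis red0 : forall x, red x = 0 -> exists y, x = y *+ 2.
Hypothesis red_period : forall x, red x ^+ (2 ^ r) = red x.
Hypothesis red_onto : forall z, z ^+ (2 ^ r) = z -> exists x, red x = z.

Let R4 : 4%:R = 0 :> R := gr4_char4 r.

Lemma red_double (x : R) : red (x *+ 2) = 0.
Proof. by rewrite rmorphMn /= -mulr_natr L2 mulr0. Qed.

Lemma red_eqP (x y : R) : red x = red y -> exists c, x = y + c *+ 2.
Proof.
move=> xy; have [c cE] : exists c, x - y = c *+ 2 by apply: red0; rewrite rmorphB xy subrr.
by exists c; rewrite -cE addrC subrK.
Qed.

Lemma red_eq_double (x y : R) : red x = red y -> x *+ 2 = y *+ 2.
Proof.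
move/red_eqP => [c ->]; rewrite mulrnDl -mulrnA -[c *+ _]mulr_natr.
by rewrite R4 mulr0 addr0.
Qed.

Lemma double_eq_red (x y : R) : x *+ 2 = y *+ 2 -> red x = red y.
Proof.
move/eqP; rewrite -subr_eq0 -mulrnBl => /eqP/gr4_tors[c cE].
by apply/eqP; rewrite -subr_eq0 -rmorphB cE red_double.
Qed.

Lemma red_eq_sqr (x y : R) : red x = red y -> x ^+ 2 = y ^+ 2.
Proof. by move/red_eqP => [c]; apply: sqr_eq_mod2. Qed.

Lemma red_eq_exp2 k (x y : R) : red x = red y -> (0 < k)%N -> x ^+ (2 ^ k) = y ^+ (2 ^ k).
Proof. by move=> xy; case: k => // k _; rewrite expnS !exprM (red_eq_sqr xy). Qed.

Lemma red_expD k (x y : R) : red ((x + y) ^+ (2 ^ k)) = red (x ^+ (2 ^ k) + y ^+ (2 ^ k)).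
Proof.
rewrite rmorphXn !rmorphD !rmorphXn /=; elim: k => [|k IH]; first by rewrite !expr1.
by rewrite expnSr !exprM IH (sqrrD2 L2).
Qed.

(** An intrinsic description of the Teichmueller set, identified with [teichmuller] in
    [teichmullerE]. *)
Definition teich (x : R) := x ^+ (2 ^ r) == x.

(** Each side equals its [2 ^ r]-th power, which depends only on the reduction. *)
Lemma teich_inj (x y : R) : teich x -> teich y -> red x = red y -> x = y.
Proof. by move=> /eqP <- /eqP <-; rewrite !rmorphXn /= !red_period => /red_eq_exp2; apply. Qed.

Lemma teichX (x : R) k : teich x -> teich (x ^+ k).
Proof. by move=> /eqP xT; rewrite /teich exprAC xT. Qed.

Lemma teichM (x y : R) : teich x -> teich y -> teich (x * y).
Proof. by move=> /eqP xT /eqP yT; rewrite /teich exprMn xT yT. Qed.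

Lemma teich_lift (x : R) : teich (x ^+ (2 ^ r)).
Proof. by apply/eqP/red_eq_exp2 => //; rewrite rmorphXn /= red_period. Qed.

Lemma teich_sqrD (u v : R) : teich u -> teich v -> teich ((u + v) ^+ 2).
Proof.
by move=> uT vT; apply/eqP; rewrite exprAC; apply: red_eq_sqr; rewrite rmorphXn /= red_period.
Qed.

Lemma teich_root (x : R) : teich x -> exists2 u, teich u & u ^+ 2 = x.
Proof.
move=> xT; exists (x ^+ (2 ^ r.-1)); first exact: teichX.
by rewrite -exprM -expnSr prednK //; apply/eqP.
Qed.

(** [x ^+ (2 ^ r)] is the first digit; the second may be replaced by its own [2 ^ r]-th power, as
    only its reduction matters after doubling. *)
Lemma teich_decomp (x : R) : exists ab : R * R, [/\ teich ab.1, teich ab.2 & x = ab.1 + 2%:R * ab.2].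
Proof.
have [c xE] : exists c, x = x ^+ (2 ^ r) + c *+ 2.
  by apply: red_eqP; rewrite rmorphXn /= red_period.
exists (x ^+ (2 ^ r), c ^+ (2 ^ r)); split; rewrite ?teich_lift //=.
rewrite mulr_natl {1}xE; congr (_ + _); apply: red_eq_double.
by rewrite rmorphXn /= red_period.
Qed.

Let two_r : (1 < 2 ^ r)%N. Proof. by rewrite -{1}(expn0 2) ltn_exp2l. Qed.

Lemma teich1 : teich 1. Proof. by rewrite /teich expr1n. Qed.

(** [2 ^ r - 1] divides [#|L| - 1], so [L] has a root of that order; by [teich_inj] its Teichmueller
    lift has the same order. *)
Lemma teich_prim_exists : exists x : R, (2 ^ r).-1.-primitive_root x.
Proof.
have [z0 z0_prim] := finField_prim_root_exists L.
have dv : ((2 ^ r).-1 %| #|L|.-1)%N.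
  by rewrite cardL; case/dvdnP: rM => k ->; rewrite mulnC expnM [X in (_ %| X)%N]predn_exp dvdn_mulr.
have z_prim := dvdn_prim_root z0_prim dv; move: (z0 ^+ _) z_prim => z z_prim.
have [x xz] : exists x, red x = z.
  apply: red_onto; rewrite -[in LHS](prednK (ltnW two_r)) exprS.
  by rewrite (prim_expr_order z_prim) mulr1.
exists (x ^+ (2 ^ r)); have xT := teich_lift x.
have eq1 k : (x ^+ (2 ^ r) ^+ k == 1) = (z ^+ k == 1).
  have redE : red (x ^+ (2 ^ r) ^+ k) = z ^+ k by rewrite !rmorphXn /= red_period xz.
  apply/eqP/eqP => [e|e]; first by rewrite -redE e rmorph1.
  by apply: teich_inj; [exact: teichX | exact: teich1 | rewrite redE e rmorph1].
case/andP: z_prim => n_gt0 /forallP zP; apply/andP; split=> //; apply/forallP => i.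
by have := zP i; rewrite !unity_rootE eq1.
Qed.

(** One inclusion is direct. The listed set has [2 ^ r] elements, and reduction embeds the other one
    in the solutions of [z ^+ (2 ^ r) = z], of which there are at most [2 ^ r]. *)
Lemma teichmullerE (x : R) : (x \in teichmuller r) = teich x.
Proof.
have gen_prim : (2 ^ r).-1.-primitive_root (teich_gen r).
  rewrite /teich_gen; case: pickP => //= no; have [y yP] := teich_prim_exists.
  by have := no y; rewrite yP.
suff -> : teichmuller r = [set x : R | teich x] by rewrite inE.
apply/eqP; rewrite eqEcard; apply/andP; split.
  apply/subsetP => y; rewrite !inE => /orP[/eqP ->|/imsetP[i _ ->]].
    by rewrite /teich expr0n expn_eq0.
  apply: teichX; rewrite /teich -{1}(prednK (ltnW two_r)) exprS.
  by rewrite (prim_expr_order gen_prim) mulr1.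
have -> : #|teichmuller r| = (2 ^ r)%N.
  rewrite cardsU1 card_imset ?card_ord; last first.
    move=> i j /eqP; rewrite (eq_prim_root_expr gen_prim) !modn_small // => /eqP.
    exact: val_inj.
  suff -> : (0 \notin [set teich_gen r ^+ i | i : 'I_(2 ^ r).-1]) = true by rewrite add1n prednK // ltnW.
  apply/negP => /imsetP[i _ /(congr1 (fun y => y ^+ (2 ^ r).-1))].
  rewrite exprAC (prim_expr_order gen_prim) expr1n expr0n; have := prim_order_gt0 gen_prim; case: (_.-1) => // n _ /eqP.
  by rewrite eq_sym oner_eq0.
have red_inj : {in [set x : R | teich x] &, injective red}.
  by move=> y z; rewrite !inE => yT zT; apply: teich_inj.
rewrite -(card_in_imset red_inj); apply: leq_trans (card_expf_fixed L two_r).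
apply/subset_leq_card/subsetP => _ /imsetP[y _ ->].
by rewrite inE red_period.
Qed.

Local Notation q := (2 ^ r./2)%N.

(** Only the reduction of [c] matters after doubling, so [c] may be any element; for sums and
    products the second digit then needs no normalisation. *)
Lemma gr4_barE (x b c : R) : teich b -> x = b + 2%:R * c ->
  gr4_bar x = b ^+ q + 2%:R * c ^+ q.
Proof.
move=> bT xE; rewrite /gr4_bar; case: pickP => [[b' c'] /=|no].
  rewrite !teichmullerE => /and3P[b'T c'T /eqP xE'].
  have bb' : b' = b.
    apply: teich_inj => //; have := congr1 red xE; rewrite {1}xE'.
    by rewrite !mulr_natl ![red (_ + _ *+ 2)]rmorphD !red_double !addr0.
  have cc' : red c' = red c.
    by apply: double_eq_red; apply: (addrI b); rewrite -(mulr_natl c' 2) -(mulr_natl c 2) -xE -[in LHS]bb'.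
  rewrite bb' !mulr_natl; congr (_ + _); apply: red_eq_double.
  by rewrite !rmorphXn /= cc'.
have [[b' c'] [/= b'T c'T xE']] := teich_decomp x.
by have := no (b', c'); rewrite /= !teichmullerE b'T c'T xE' eqxx.
Qed.

Lemma gr4_bar_teich (x : R) : teich x -> gr4_bar x = x ^+ q.
Proof.
move=> xT; rewrite (@gr4_barE x x 0) ?mulr0 ?addr0 //.
by rewrite expr0n expn_eq0 mulr0 addr0.
Qed.

(* If [u] and [v] are Teichmueller representatives then so is [(u + v) ^+ 2], and it is
   [u ^+ 2 + v ^+ 2] up to a multiple of 2. *)
Lemma gr4_barD (x y : R) : gr4_bar (x + y) = gr4_bar x + gr4_bar y.
Proof.
have [[b c] [/= bT cT xE]] := teich_decomp x; have [[b' c'] [/= b'T c'T yE]] := teich_decomp y.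
have [u uT ub] := teich_root bT; have [v vT vb] := teich_root b'T.
rewrite (gr4_barE bT xE) (gr4_barE b'T yE).
have xyE : x + y = (u + v) ^+ 2 + 2%:R * (c + c' + u * v).
  have -> : (u + v) ^+ 2 + 2%:R * (c + c' + u * v) = x + y + 4%:R * (u * v) by rewrite xE yE -ub -vb; ring.
  by rewrite R4 mul0r addr0.
rewrite (gr4_barE (teich_sqrD uT vT) xyE).
have -> : (u + v) ^+ 2 ^+ q = (u ^+ q + v ^+ q) ^+ 2 by rewrite exprAC; apply/red_eq_sqr/red_expD.
have -> : 2%:R * (c + c' + u * v) ^+ q = 2%:R * (c ^+ q + c' ^+ q + (u * v) ^+ q).
  by rewrite !mulr_natl; apply: red_eq_double; rewrite red_expD !rmorphD red_expD rmorphD.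
rewrite -ub -vb exprMn ![_ ^+ 2 ^+ q]exprAC.
move: (u ^+ q) (v ^+ q) (c ^+ q) (c' ^+ q) => s t d d'.
have -> : (s + t) ^+ 2 + 2%:R * (d + d' + s * t) = s ^+ 2 + 2%:R * d + (t ^+ 2 + 2%:R * d') + 4%:R * (s * t) by ring.
by rewrite R4 mul0r addr0.
Qed.

Lemma gr4_barM (x y : R) : gr4_bar (x * y) = gr4_bar x * gr4_bar y.
Proof.
have [[b c] [/= bT cT xE]] := teich_decomp x; have [[b' c'] [/= b'T c'T yE]] := teich_decomp y.
rewrite (gr4_barE bT xE) (gr4_barE b'T yE).
have xyE : x * y = b * b' + 2%:R * (b * c' + b' * c).
  have -> : x * y = b * b' + 2%:R * (b * c' + b' * c) + 4%:R * (c * c') by rewrite xE yE; ring.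
  by rewrite R4 mul0r addr0.
rewrite (gr4_barE (teichM bT b'T) xyE).
have -> : 2%:R * (b * c' + b' * c) ^+ q = 2%:R * ((b * c') ^+ q + (b' * c) ^+ q).
  by rewrite !mulr_natl; apply/red_eq_double/red_expD.
rewrite !exprMn; move: (b ^+ q) (b' ^+ q) (c ^+ q) (c' ^+ q) => s t d d'.
have -> : (s + 2%:R * d) * (t + 2%:R * d') = s * t + 2%:R * (s * d' + t * d) + 4%:R * (d * d') by ring.
by rewrite R4 mul0r addr0.
Qed.

Lemma gr4_bar_zmod : zmod_morphism (@gr4_bar r).
Proof. by move=> x y; apply: (addIr (gr4_bar y)); rewrite -gr4_barD !subrK. Qed.

Lemma gr4_bar_monoid : monoid_morphism (@gr4_bar r).
Proof. by split; [rewrite gr4_bar_teich ?teich1 ?expr1n | exact: gr4_barM]. Qed.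

End Bar.

(** * A point with its conjugation over each coset *)

Section PointExists.
Variables (L : finFieldType) (L2 : 2%:R = 0 :> L) (M : nat) (cardL : #|L| = (2 ^ M)%N).
Variables (m : nat) (odd_m : odd m) (w : L) (w_prim : m.-primitive_root w) (N : nat).

(** The root is the Teichmueller lift of [w ^+ h]. Conjugation raises it to the power [2 ^ r./2],
    which by [opp_mod_half] gives its inverse when the coset is self-inverse. *)
Lemma gr4_point (h : 'I_m) (r := #|coset2 m h|) : (0 < h)%N -> (r %| M)%N ->
  exists (P : point w h) (bar : {rmorphism P -> P}),
  (opp_mod h \in coset2 m h -> bar (point_root P) = point_root P ^+ m.-1) /\
  #|[set D : {set 'rV[P]_N} | cyclic_code D &
      (opp_mod h \in coset2 m h) ==> (D == twisted_dual bar D)]| =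
  if opp_mod h \in coset2 m h then num_hermitian_self_dual r N else num_cyclic (GR4 r) N.
Proof.
move=> h_gt0 rM; have period := coset2_period odd_m h; rewrite -/r in period.
have r_gt0 : (0 < r)%N := coset2_gt0 h.
have w1 : w ^+ m = 1 := prim_expr_order w_prim.
have [red [red0 redP red_onto]] := gr4_red_exists L2 r_gt0 rM cardL.
have whr : (w ^+ h) ^+ (2 ^ r) = w ^+ h.
  by rewrite -exprM; apply/eqP; rewrite (eq_prim_root_expr w_prim); apply/eqP.
have [x xw] := red_onto _ whr.
pose z : GR4 r := x ^+ (2 ^ r).
have zT : teich z by apply: teich_lift red0 redP _.
have redz : red z = w ^+ h by rewrite rmorphXn /= xw whr.
have z1 : z ^+ m = 1.
  apply: (teich_inj r_gt0 red0 redP); [exact: teichX | exact: teich1 |].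
  by rewrite rmorphXn /= redz rmorph1 exprAC w1 expr1n.
move: z zT redz z1 => z zT redz z1.
pose P : point w h := Point (gr4_char4 r) red0 (@gr4_tors r) (card_gr4 r_gt0) z1 redz (gr4_functional r).
have barZ := gr4_bar_zmod L2 r_gt0 rM cardL red0 redP red_onto.
have barM := gr4_bar_monoid L2 r_gt0 rM cardL red0 redP red_onto.
pose bar : {rmorphism GR4 r -> GR4 r} := HB.pack (@gr4_bar r)
  (GRing.isZmodMorphism.Build (GR4 r) (GR4 r) (@gr4_bar r) barZ)
  (GRing.isMonoidMorphism.Build (GR4 r) (GR4 r) (@gr4_bar r) barM).
exists P, bar; split=> [hh|].
  have E := opp_mod_half odd_m h_gt0 hh.
  rewrite /= (gr4_bar_teich L2 r_gt0 rM cardL red0 redP red_onto zT).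
  apply: (teich_inj r_gt0 red0 redP); [exact: teichX | exact: teichX |].
  rewrite !rmorphXn /= redz -(w_opp odd_m w_prim) E val_iter_dbl.
  by rewrite -exprM (expr_mod _ w1).
by case: ifP => hh; apply: eq_card => D; rewrite !inE ?andbT.
Qed.

(** Over the coset {0} the ring is ['Z_4] itself rather than [GR4 1], with root 1 and trivial
    conjugation, so the count is literally the Euclidean one. *)
Lemma Z4_point (h : 'I_m) : h = 0%N :> nat ->
  exists (P : point w h) (bar : {rmorphism P -> P}),
  (opp_mod h \in coset2 m h -> bar (point_root P) = point_root P ^+ m.-1) /\
  #|[set D : {set 'rV[P]_N} | cyclic_code D &
      (opp_mod h \in coset2 m h) ==> (D == twisted_dual bar D)]| =
  num_euclid_self_dual 'Z_4 N.
Proof.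
move=> h0; pose red : {rmorphism 'Z_4 -> L} := emb2 L2 \o red2.
have Z4_even (c : 'Z_4) : ~~ odd c -> exists d : 'Z_4, c = d *+ 2.
  by move=> c_even; exists (inZp c./2); rewrite Z4_half.
have red0 (c : 'Z_4) : red c = 0 -> exists d, c = d *+ 2.
  by move/eqP; rewrite fmorph_eq0 red2_eq0; apply: Z4_even.
have tors (c : 'Z_4) : c *+ 2 = 0 -> exists d, c = d *+ 2 by move/Z4_double_eq0/Z4_even.
have card1 : #|coset2 m h| = 1%N.
  apply/eqP/cards1P; exists h; apply/setP => k; rewrite !inE h0.
  apply/existsP/eqP => [[i]|->]; first by rewrite mul0n mod0n => /eqP k0; apply/val_inj; rewrite /= h0.
  by exists h; rewrite mul0n mod0n h0.
have cardZ4 : #|'Z_4| = (4 ^ #|coset2 m h|)%N by rewrite card1 card_ord.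
have Z4_4 : 4%:R = 0 :> 'Z_4 by apply/val_inj.
have redz : red 1 = w ^+ h by rewrite h0 rmorph1.
have func : exists f : 'Z_4 -> 'Z_4, {morph f : x y / x + y} /\ f 2%:R = 2%:R by exists id.
pose P : point w h := Point Z4_4 red0 tors cardZ4 (expr1n _ m) redz func.
exists P, idfun; split=> [_|]; first by rewrite /= expr1n.
have -> : opp_mod h \in coset2 m h.
  suff -> : opp_mod h = h by apply: mem_coset2.
  by apply/val_inj; rewrite /= h0 subn0 modnn.
exact: eq_card.
Qed.

End PointExists.

(* MathComp also has a [self_inverse], which shadows the one of [Defs]. *)
Local Notation self_inverse := Defs.self_inverse.

(** * Coset representatives *)

Section Representatives.
Variables (m : nat) (odd_m : odd m).
Implicit Types (h i j l : 'I_m) (J : {set 'I_m}).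

Lemma self_inverseE h : self_inverse h = (opp_mod h \in coset2 m h).
Proof. by rewrite /self_inverse eq_sym; exact: (sameP eqP (coset2_eqP odd_m _ _)). Qed.

Lemma self_inverse_coset h l : l \in coset2 m h -> self_inverse l = self_inverse h.
Proof.
move=> lh; rewrite /self_inverse; have /(coset2_eqP odd_m) <- := lh.
by move: lh; rewrite -coset2_opp // => /(coset2_eqP odd_m) ->.
Qed.

Lemma self_inverse_opp h : self_inverse (opp_mod h) = self_inverse h.
Proof. by rewrite /self_inverse opp_modK // eq_sym. Qed.

Lemma opp_mod0 j : j = 0%N :> nat -> opp_mod j = 0%N :> nat.
Proof. by move=> /= ->; rewrite subn0 modnn. Qed.

Lemma opp_mod_eq0 j : (opp_mod j == 0%N :> nat) = (j == 0%N :> nat).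
Proof. by apply/eqP/eqP => [/opp_mod0|/opp_mod0 //]; rewrite opp_modK. Qed.

Lemma coset2_0 l : (l \in coset2 m 0) = (l == 0%N :> nat).
Proof.
apply/coset2P/eqP => [[i ->]|->]; first by rewrite mul0n mod0n.
by exists 0%N; rewrite mul0n mod0n.
Qed.

Lemma coset2_eq0 h : (coset2 m h == coset2 m 0) = (h == 0%N :> nat).
Proof.
apply/eqP/eqP => [E|->] //.
by apply/eqP; rewrite -coset2_0 -E mem_coset2.
Qed.

Lemma mem_I1 l : (l \in I1 m) = self_inverse l && (l != 0%N :> nat).
Proof.
apply/bigcupP/andP => [[h /andP[sh h0] lh]|[sl l0]].
  rewrite (self_inverse_coset lh) sh; split=> //.
  by rewrite -coset2_eq0; have /(coset2_eqP odd_m) <- := lh.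
by exists l; rewrite ?mem_coset2 // sl coset2_eq0.
Qed.

Lemma mem_I2 l : (l \in I2 m) = ~~ self_inverse l.
Proof.
rewrite in_setC in_setU coset2_0 mem_I1; have [l0|] := eqVneq (nat_of_ord l) 0%N; last by rewrite andbT.
rewrite self_inverseE (_ : opp_mod l = l) ?mem_coset2 //.
by apply/val_inj; rewrite /= l0 subn0 modnn.
Qed.

Lemma coset_reps_sub J I : coset_reps J I -> J \subset I.
Proof. by case/and3P. Qed.

Lemma coset_reps_ex J I l : coset_reps J I -> l \in I -> exists2 i, i \in J & l \in coset2 m i.
Proof.
case/and3P => _ _ /forall_inP one lI.
have /one/cards1P[i iE] : coset2 m l \in [set coset2 m (val h) | h in I] by apply: imset_f.
have /setIP[iJ il] : i \in J :&: coset2 m l by rewrite iE set11.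
by exists i; rewrite // coset2_sym.
Qed.

Lemma coset_reps_uniq J I i j : coset_reps J I -> i \in J -> j \in J -> j \in coset2 m i -> i = j.
Proof.
case/and3P => _ /subsetP JI /forall_inP one iJ jJ ji.
have /one/cards1P[k kE] : coset2 m i \in [set coset2 m (val h) | h in I].
  by apply: imset_f; apply: JI.
have : i \in J :&: coset2 m i by rewrite inE iJ mem_coset2.
have : j \in J :&: coset2 m i by rewrite inE jJ ji.
by rewrite kE !inE => /eqP -> /eqP ->.
Qed.

End Representatives.

(** * The product formula over coset representatives *)

Local Open Scope nat_scope.

Theorem corollary4p9 (m a n : nat) (J1 J2 J2' J2'' : {set 'I_m}) :
  odd m -> 1 <= a -> n = m * 2 ^ a ->
  coset_reps J1 (I1 m) ->
  coset_reps J2 (I2 m) ->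
  (forall h : 'I_m, (h \in J2) = (opp_mod h \in J2)) ->
  J2 = J2' :|: J2'' -> [disjoint J2' & J2''] ->
  J2'' = [set opp_mod h | h in J2'] ->
  num_euclid_self_dual 'Z_4 n =
    num_euclid_self_dual 'Z_4 (2 ^ a)
    * (\prod_(h in J1) num_hermitian_self_dual #|coset2 m h| (2 ^ a))
    * (\prod_(k in J2') num_cyclic (GR4 #|coset2 m k|) (2 ^ a)).
Proof.
move=> odd_m _ nE repJ1 repJ2 oppJ2 J2E disJ2 J2''E.
have m_gt0 : 0 < m := odd_gt0 odd_m.
pose o0 : 'I_m := Ordinal m_gt0.
(* [totient m] makes m divide 2^M - 1; [m`!] makes every m_h divide M. *)
pose M := totient m * m`!.
have M_gt0 : 0 < M by rewrite muln_gt0 totient_gt0 m_gt0 fact_gt0.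
have [L charL cardL] := pPrimePowerField (isT : prime 2) M_gt0.
have L2 : (2%:R = 0 :> L)%R := pcharf0 charL.
have [w w_prim] : exists w : L, (m.-primitive_root w)%R.
  have [z z_prim] := finField_prim_root_exists L.
  have dv : m %| #|L|.-1.
    rewrite cardL -subn1 -eqn_mod_dvd ?expn_gt0 // expnM.
    by rewrite -modnXm Euler_exp_totient ?coprime2n // modnXm exp1n.
  by exists (z ^+ (#|L|.-1 %/ m))%R; apply: dvdn_prim_root.
pose cnt h := if h == o0 then num_euclid_self_dual 'Z_4 (2 ^ a) else
  if opp_mod h \in coset2 m h then num_hermitian_self_dual #|coset2 m h| (2 ^ a)
  else num_cyclic (GR4 #|coset2 m h|) (2 ^ a).
(* Point and conjugation form one dependent pair, so that a single finite choice selects both. *)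
have /fin_all_exists[Pb PbE] : forall h : 'I_m, exists Pb : {P : point w h & {rmorphism P -> P}},
   (opp_mod h \in coset2 m h ->
     projT2 Pb (point_root (projT1 Pb)) = (point_root (projT1 Pb) ^+ m.-1)%R) /\
   #|[set D : {set 'rV[projT1 Pb]_(2 ^ a)} | cyclic_code D &
      (opp_mod h \in coset2 m h) ==> (D == twisted_dual (projT2 Pb) D)]| = cnt h.
  move=> h; rewrite /cnt; have [->|h0] := eqVneq h o0.
    by have [P [bar]] := Z4_point L2 w (2 ^ a) (erefl (o0 : nat)); exists (existT _ P bar).
  have h_gt0 : 0 < h by rewrite lt0n.
  have rM : #|coset2 m h| %| M.
    by rewrite dvdn_mull // dvdn_fact // coset2_gt0 ?coset2_le.
  by have [P [bar]] := gr4_point L2 cardL odd_m w_prim (2 ^ a) h_gt0 rM; exists (existT _ P bar).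
have J2'J2 : J2' \subset J2 by rewrite J2E subsetUl.
have inJ1 i : i \in J1 -> self_inverse i && (i != 0 :> nat).
  by move/(subsetP (coset_reps_sub repJ1)); rewrite mem_I1.
have inJ2 i : i \in J2 -> ~~ self_inverse i.
  by move/(subsetP (coset_reps_sub repJ2)); rewrite mem_I2.
have inJ2' i : i \in J2' -> ~~ self_inverse i by move/(subsetP J2'J2)/inJ2.
have o0S : self_inverse o0.
  by apply: contraT; rewrite -mem_I2 // in_setC in_setU coset2_0.
rewrite (card_euclid_self_dual L2 odd_m w_prim nE (I := o0 |: (J1 :|: J2'))
  (P := fun i => projT1 (Pb i)) (bar := fun i => projT2 (Pb i))).
- rewrite (eq_bigr cnt) => [|i _]; last by case: (PbE i).
  rewrite big_setU1 /=; last first.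
    rewrite in_setU; apply/norP; split; apply/negP; first by move/inJ1; rewrite andbF.
    by move/inJ2'; rewrite o0S.
  rewrite (eq_bigl [in [predU J1 & J2']]) => [|i]; last by rewrite !inE.
  rewrite bigU /=; last first.
    by rewrite disjoint_subset; apply/subsetP => i /inJ1/andP[si _]; apply/negP => /inJ2'; rewrite si.
  rewrite mulnA; congr (_ * _ * _).
  + apply: eq_bigr => i /inJ1/andP[si i0]; rewrite /cnt -self_inverseE // si.
    by rewrite -val_eqE (negPf i0).
  + apply: eq_bigr => i /inJ2' si; rewrite /cnt -self_inverseE // (negPf si).
    by case: eqP => // i0; rewrite i0 o0S in si.
(* Cosets represented in [J2''] are reached as negatives of those represented in [J2']. *)
- move=> l; have [l0|l0] := eqVneq (nat_of_ord l) 0.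
    exists o0; first by rewrite setU11.
    by rewrite (_ : l = o0) ?mem_coset2 //; apply/val_inj.
  have [sl|sl] := boolP (self_inverse l).
    have [i iJ li] : exists2 i, i \in J1 & l \in coset2 m i.
      by apply: coset_reps_ex repJ1 _ => //; rewrite mem_I1 // sl.
    by exists i; rewrite ?li // !inE iJ orbT.
  have [i iJ li] : exists2 i, i \in J2 & l \in coset2 m i.
    by apply: coset_reps_ex repJ2 _ => //; rewrite mem_I2.
  move: iJ; rewrite J2E => /setUP[iJ|]; first by exists i; rewrite ?li // !inE iJ !orbT.
  rewrite J2''E => /imsetP[k kJ ik]; exists k; first by rewrite !inE kJ !orbT.
  by rewrite -ik li orbT.
- move=> i j iI jI neq_ij.
  (* The cases [j] and [-j] are treated together through [c]. *)
  suff key c : (c = j) \/ (c = opp_mod j) -> c \notin coset2 m i.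
    by rewrite !key //; [right | left].
  move=> cj; apply/negP => ci.
  have sij : self_inverse j = self_inverse i.
    by rewrite -(self_inverse_coset odd_m ci); case: cj => ->; rewrite ?self_inverse_opp.
  have c0 : (c == 0 :> nat) = (j == 0 :> nat).
    by case: cj => ->; rewrite ?opp_mod_eq0.
  have zij : (j == 0 :> nat) = (i == 0 :> nat).
    by rewrite -c0 -!coset2_eq0 //; have /(coset2_eqP odd_m) <- := ci.
  have [i0|i0] := eqVneq (nat_of_ord i) 0.
    move: zij; rewrite i0 eqxx => /eqP j0; case/eqP: neq_ij.
    by apply/val_inj; rewrite /= i0 j0.
  have rep k : k \in o0 |: (J1 :|: J2') -> k != 0 :> nat -> k \in J1 \/ k \in J2'.
    by case/setU1P=> [-> //|/setUP].
  have j0 : j != 0 :> nat by rewrite zij.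
  have [iJ|iJ] := rep i iI i0.
    have /andP[si _] := inJ1 _ iJ.
    have [jJ|/inJ2'] := rep j jI j0; last by rewrite sij si.
    have ji : j \in coset2 m i.
      case: cj ci => -> //; move: sij; rewrite si self_inverseE // => /(coset2_eqP odd_m) E.
      by rewrite coset2_sym // -E coset2_sym.
    by rewrite (coset_reps_uniq repJ1 iJ jJ ji) eqxx in neq_ij.
  have [/inJ1/andP[sj _]|jJ] := rep j jI j0.
    by move/negP: (inJ2' _ iJ); apply; rewrite -sij.
  have iJ2 := subsetP J2'J2 _ iJ; have jJ2 := subsetP J2'J2 _ jJ.
  case: cj ci => -> ci; first by rewrite (coset_reps_uniq repJ2 iJ2 jJ2 ci) eqxx in neq_ij.
  have ojJ2 : opp_mod j \in J2 by rewrite -oppJ2.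
  have iE := coset_reps_uniq repJ2 iJ2 ojJ2 ci.
  (* [i = -j] would put [i] in both [J2'] and [J2'']. *)
  move/pred0P/(_ i): disJ2; rewrite /= iJ J2''E iE /=.
  by rewrite imset_f.
- by move=> i _; case: (PbE i).
Qed.
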